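(* Let $d\ge2$ and let $K:\mathbb{S}^{d-1}\times\mathbb{S}^{d-1}\to\mathbb{C}$ be a kernel of the form $$K(\xi,\zeta)=\sum_{j,j'=0}^{\infty}\sum_{k=1}^{N_{j,d}}\sum_{k'=1}^{N_{j',d}}a_{j,j',k,k'}\,Y_j^k(\xi)\,\overline{Y_{j'}^{k'}(\zeta)},\qquad \xi,\zeta\in\mathbb{S}^{d-1},$$ with $$\sum_{j,j'=0}^{\infty}\sum_{k=1}^{N_{j,d}}\sum_{k'=1}^{N_{j',d}}|a_{j,j',k,k'}|\,\sqrt{\frac{N_{j,d}N_{j',d}}{\sigma_{d-1}^2}}<\infty .$$ Then $K(\xi,\zeta)=K(-\xi,-\zeta)$ for all $\xi,\zeta\in\mathbb{S}^{d-1}$ if and only if $a_{j,j',k,k'}=0$ for all $j,j'$ with $j+j'$ odd and all $1\le k\le N_{j,d}$, $1\le k'\le N_{j',d}$.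
   Context: $\mathbb{S}^{d-1}$ is the unit sphere in $\mathbb{R}^d$ and $\sigma_{d-1}$ its surface area. For each $j\ge0$, $Y_j^1,\ldots,Y_j^{N_{j,d}}$ is a fixed orthonormal basis (in $L^2(\mathbb{S}^{d-1})$ with surface measure) of the space of spherical harmonics of degree $j$, which has dimension $N_{j,d}$: $N_{0,d}=1$, $N_{j,d}=\frac{(2j+d-2)(j+d-3)!}{j!(d-2)!}$ for $j\ge1$. *)

(* Defs.v *)
From HB Require Import structures.
From mathcomp Require Import all_boot all_order all_algebra.
(* The notations of mpoly clash with those of analysis. *)
From mathcomp Require Import -(notations) mpoly.
From mathcomp Require Import all_classical all_reals all_analysis.
From mathcomp Require Import measurable_realfun.
From mathcomp Require Import complex.

Set Implicit Arguments.
Unset Strict Implicit.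
Unset Printing Implicit Defensive.

Import Order.TTheory GRing.Theory Num.Theory.
Import numFieldNormedType.Exports.

Local Open Scope classical_set_scope.
Local Open Scope ring_scope.
Local Open Scope complex_scope.

Section lebesgue_tuple.
Context (R : realType).

(* [lebesgue_measure] lives on [measurableTypeR R], whereas [n.-tuple R] uses the
   (equal) Borel sigma-algebra declared on [R] itself. *)
Definition tuple_cons n (p : measurableTypeR R * n.-tuple R) : n.+1.-tuple R :=
  [tuple of (p.1 : R) :: p.2].

Definition tuple_uncons n (x : n.+1.-tuple R) : measurableTypeR R * n.-tuple R :=
  (thead x, [tuple of behead x]).

Lemma tuple_consK n : cancel (@tuple_cons n) (@tuple_uncons n).
Proof.
by case=> x t; rewrite /tuple_uncons /tuple_cons theadE; congr pair; apply/val_inj.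
Qed.

Lemma measurable_tuple_cons n : measurable_fun setT (@tuple_cons n).
Proof.
apply: (@measurable_cons _ _ _ _ (fun p => p.1 : R)); last exact: measurable_snd.
by move=> mT A mA; exact: (measurable_fst mT).
Qed.

Lemma measurable_tuple_uncons n : measurable_fun setT (@tuple_uncons n).
Proof.
apply/measurable_fun_pair; last exact: measurable_behead.
by move=> mT A mA; exact: (measurable_tnth ord0 mT).
Qed.

Section lebesgue_tupleS.
Context n (m : {sigma_finite_measure set (n.-tuple R) -> \bar R}).

Definition lebesgue_tupleS : set (n.+1.-tuple R) -> \bar R :=
  pushforward (@lebesgue_measure R \x m)%E (@tuple_cons n).

Let lebesgue_tupleS0 : lebesgue_tupleS set0 = 0%E.
Proof. by rewrite /lebesgue_tupleS /pushforward preimage_set0 measure0. Qed.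

Let lebesgue_tupleS_ge0 A : (0 <= lebesgue_tupleS A)%E.
Proof. by rewrite /lebesgue_tupleS /pushforward measure_ge0. Qed.

Let lebesgue_tupleS_sigma_additive : semi_sigma_additive lebesgue_tupleS.
Proof.
apply: measure_semi_sigma_additive; exact: measurable_tuple_cons.
Qed.

HB.instance Definition _ := isMeasure.Build _ _ _ lebesgue_tupleS
  lebesgue_tupleS0 lebesgue_tupleS_ge0 lebesgue_tupleS_sigma_additive.

Let lebesgue_tupleS_sigma_finite : sigma_finite setT lebesgue_tupleS.
Proof.
have /sigma_finiteP[F [TF ndF Foo]] := sigma_finiteT (@lebesgue_measure R).
have /sigma_finiteP[G [TG ndG Goo]] := sigma_finiteT m.
exists (fun k => @tuple_uncons n @^-1` (F k `*` G k)).
  rewrite -preimage_bigcup (_ : \bigcup_k _ = setT) ?preimage_setT//.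
  apply/seteqP; split=> // -[x t] _.
  have [k _ Fkx] : (\bigcup_k F k) x by rewrite -TF.
  have [l _ Glt] : (\bigcup_k G k) t by rewrite -TG.
  exists (maxn k l) => //; split=> /=.
    by move: x Fkx; exact/subsetPset/ndF/leq_maxl.
  by move: t Glt; exact/subsetPset/ndG/leq_maxr.
move=> k; have [mF Fkoo] := Foo k; have [mG Gkoo] := Goo k; split.
  rewrite -[X in measurable X]setTI.
  by apply: measurable_tuple_uncons => //; exact: measurableX.
rewrite /lebesgue_tupleS /pushforward -comp_preimage (_ : _ \o _ = id).
  by rewrite preimage_id product_measure1E// lte_mul_pinfty// ge0_fin_numE.
by apply/funext => p; exact: tuple_consK.
Qed.

HB.instance Definition _ := Measure_isSigmaFinite.Build _ _ _ lebesgue_tupleS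
  lebesgue_tupleS_sigma_finite.

End lebesgue_tupleS.

(* Lebesgue measure on R^n, as an iterated product measure transported along
   (x_0, (x_1, ..., x_n)) |-> (x_0, ..., x_n). *)
Fixpoint lebesgue_tuple n : {sigma_finite_measure set (n.-tuple R) -> \bar R} :=
  match n with
  | 0 => \d_([tuple] : 0.-tuple R)
  | n'.+1 => lebesgue_tupleS (lebesgue_tuple n')
  end.

End lebesgue_tuple.

Section sphere.
Context (R : realType) (d : nat).
Implicit Types x : d.-tuple R.

Definition enorm x : R := Num.sqrt (\sum_(i < d) tnth x i ^+ 2).

Definition sphere : set (d.-tuple R) := [set x | enorm x = 1].

Definition antipode x : d.-tuple R := [tuple - tnth x i | i < d].

Definition normalize x : d.-tuple R := [tuple (enorm x)^-1 * tnth x i | i < d].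

Definition punctured_ball : set (d.-tuple R) := [set x | 0 < enorm x <= 1].

Lemma measurable_sumsq :
  measurable_fun setT (fun x => \sum_(i < d) tnth x i ^+ 2).
Proof.
apply: measurable_sum => i; apply: measurable_funX; exact: measurable_tnth.
Qed.

Lemma measurable_enorm : measurable_fun setT enorm.
Proof.
rewrite (_ : enorm = (@powR R ^~ 2^-1) \o (fun x => \sum_(i < d) tnth x i ^+ 2)).
  by apply: measurableT_comp; [exact: measurable_powR|exact: measurable_sumsq].
by apply/funext => x /=; rewrite powR12_sqrt// sumr_ge0// => i _; exact: sqr_ge0.
Qed.

Lemma measurable_normalize : measurable_fun setT normalize.
Proof.
apply/measurable_fun_tnthP => i.
rewrite (_ : _ \o _ = (fun x => enorm x `^ (-1) * tnth x i)).
  apply: measurable_funM; last exact: measurable_tnth.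
  by apply: (measurableT_comp (measurable_powR (-1))); exact: measurable_enorm.
by apply/funext => x /=; rewrite tnth_mktuple powR_inv1// sqrtr_ge0.
Qed.

Lemma measurable_punctured_ball : measurable punctured_ball.
Proof.
rewrite (_ : punctured_ball = enorm @^-1` `]0, 1]%classic).
  by rewrite -[X in measurable X]setTI; exact: measurable_enorm.
by apply/seteqP; split=> x /=; rewrite in_itv.
Qed.

(* The part of the unit ball lying on the rays from the origin through [A]. *)
Definition cone (A : set (d.-tuple R)) : set (d.-tuple R) :=
  normalize @^-1` A `&` punctured_ball.

(* sigma(A) = d * Leb(cone A), as given by integration in polar coordinates.
   This is a measure on all of R^d, carried by the sphere. *)
Definition surface_measure (A : set (d.-tuple R)) : \bar R :=
  (d%:R%:E * lebesgue_tuple R d (cone A))%E.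

Let surface_measure0 : surface_measure set0 = 0%E.
Proof. by rewrite /surface_measure /cone preimage_set0 set0I measure0 mule0. Qed.

Let surface_measure_ge0 A : (0 <= surface_measure A)%E.
Proof. by rewrite /surface_measure mule_ge0. Qed.

Let surface_measure_sigma_additive : semi_sigma_additive surface_measure.
Proof.
apply: (measure_semi_sigma_additive (s := mscale (d%:R%:nng : {nonneg R})
  (pushforward (mrestr (lebesgue_tuple R d) measurable_punctured_ball) normalize))).
exact: measurable_normalize.
Qed.

HB.instance Definition _ := isMeasure.Build _ _ _ surface_measure
  surface_measure0 surface_measure_ge0 surface_measure_sigma_additive.

End sphere.

Section spherical_harmonics.
Context (R : realType) (d : nat).

Definition surface_area : R := fine (surface_measure (@sphere R d)).

Definition sphere_integral (f : d.-tuple R -> R[i]) : R[i] :=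
  (\int[@surface_measure R d]_(x in @sphere R d) complex.Re (f x))%R +i*
  (\int[@surface_measure R d]_(x in @sphere R d) complex.Im (f x))%R.

Definition inner (f g : d.-tuple R -> R[i]) : R[i] :=
  sphere_integral (fun x => f x * (g x)^*).

Definition laplacian (p : mpoly d R[i]) : mpoly d R[i] :=
  \sum_(i < d) mderiv i (mderiv i p).

(* Functions on the sphere are represented by functions on R^d whose values
   outside the sphere are irrelevant. *)
Definition spherical_harmonic (j : nat) (f : d.-tuple R -> R[i]) : Prop :=
  exists p : mpoly d R[i],
    [/\ p \is ishomog1 j mdeg,
        laplacian p = 0 &
        forall x, sphere x -> f x = meval (fun i => (tnth x i)%:C) p].

Definition orthonormal_basis_of_harmonics (j N : nat)
    (Y : 'I_N -> d.-tuple R -> R[i]) : Prop :=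
  [/\ forall k, spherical_harmonic j (Y k),
      forall k l, inner (Y k) (Y l) = (k == l)%:R &
      forall f, spherical_harmonic j f ->
        exists c : 'I_N -> R[i],
          forall x, sphere x -> f x = \sum_(k < N) c k * Y k x].

End spherical_harmonics.

(* N_{j,d}; for d >= 2 the division is exact. *)
Definition harmonic_dim (d j : nat) : nat :=
  if j is 0 then 1%N
  else ((2 * j + d - 2) * (j + d - 3)`! %/ (j`! * (d - 2)`!))%N.

(* Main.v *)
Require Import Defs.
From HB Require Import structures.
From mathcomp Require Import all_boot all_order all_algebra.
From mathcomp Require Import ring lra zify.
From mathcomp Require Import -(notations) mpoly.
From mathcomp Require Import all_classical all_reals all_analysis.
From mathcomp Require Import measurable_realfun complex.

Set Implicit Arguments.
Unset Strict Implicit.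
Unset Printing Implicit Defensive.

Import Order.TTheory GRing.Theory Num.Theory.
Import numFieldNormedType.Exports.

Local Open Scope classical_set_scope.
Local Open Scope ring_scope.
Local Open Scope complex_scope.

(** The difference K(xi, zeta) - K(-xi, -zeta) has the coefficients
    (1 - (-1)^(j + j')) a, so everything reduces to the uniqueness of the
    coefficients of a double expansion that tends to 0 on the sphere. This follows
    by integrating termwise against the harmonics, first in xi for almost every
    zeta and then in zeta. Domination needs no addition theorem: as the harmonics
    are normalised, AM-GM bounds the integral of a product of two of them by 1.

    Harmonics of different degrees are orthogonal because the Casimir operator
    (the sum of the squares of the fields x_i d_j - x_j d_i) is symmetric and acts
    on harmonic polynomials of degree j as the scalar -2 j (j + d - 2). Its
    symmetry comes from the rotation invariance of the surface measure: a plane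
    rotation is a product of three shears, which preserve Lebesgue measure by
    Fubini, and with t = tan(theta / 2) the integral of a rotated polynomial,
    times a power of 1 + t^2, is a polynomial in t. *)

(** * Measure-preserving maps *)

Section measure_preserving.
Context d (T : measurableType d) (R : realType) (m : set T -> \bar R).

Definition measure_preserving (f : T -> T) :=
  measurable_fun setT f /\ forall A, measurable A -> m (f @^-1` A) = m A.

Lemma measure_preserving_comp f g :
  measure_preserving f -> measure_preserving g -> measure_preserving (f \o g).
Proof.
move=> [mf pf] [mg pg]; split; first exact: measurableT_comp.
move=> A mA; rewrite comp_preimage pg ?pf//.
by rewrite -[X in measurable X]setTI; exact: mf.
Qed.

End measure_preserving.

(** * Shears and Lebesgue measure *)

Section shears.
Context (R : realType).
Local Notation leb := (lebesgue_tuple R).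

(** Lebesgue measure is determined by its values on the intervals $]a,b]$, whose lengths a
    translation keeps. *)
Lemma lebesgue_measure_translate (c : R) (A : set (measurableTypeR R)) :
  measurable A ->
  lebesgue_measure ((fun x : measurableTypeR R => x + c) @^-1` A)
  = lebesgue_measure A.
Proof.
have mc : measurable_fun setT ((fun x => x + c) : measurableTypeR R -> measurableTypeR R).
  by apply: measurable_funD => //; exact: measurable_cst.
move=> mA; symmetry.
apply: (@lebesgue_measure_unique _ (pushforward lebesgue_measure
  ((fun x => x + c) : measurableTypeR R -> measurableTypeR R))) => //.
move=> _ [[a b] _ <-] /=.
rewrite /pushforward.
rewrite (_ : _ @^-1` _ = `]a - c, b - c]%classic); last first.
  by apply/seteqP; split=> x /=; rewrite !in_itv/= ltrBlDr lerBrDr.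
rewrite !lebesgue_measure_itv/= !lte_fin ltrD2r.
by case: ifP => // _; rewrite -!EFinB; congr (_%:E); ring.
Qed.

Section product.
Context d (T : measurableType d) (m : {sigma_finite_measure set T -> \bar R}).
Local Notation lam := (@lebesgue_measure R).

(** The $x$-section of a preimage is the preimage under [g x] of the $x$-section, so the integrands
    that define the two measures agree at every $x$. *)
Lemma product_preserving_right (g : R -> T -> T) :
  (forall x, measure_preserving m (g x)) ->
  measurable_fun setT (fun p : measurableTypeR R * T => (p.1, g p.1 p.2)) ->
  measure_preserving (lam \x m)%E (fun p => (p.1, g p.1 p.2)).
Proof.
move=> pg mg; split=> // A mA.
rewrite /product_measure1; apply: eq_integral => x _ /=.
rewrite -[RHS](proj2 (pg x)); last exact: measurable_xsection.
by congr (m _); apply/seteqP; split=> y /=; rewrite /xsection/= !inE.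
Qed.

(** At a fixed second coordinate the map is a translation. Uniqueness of the product measure allows
    the order of integration to be reversed, so that these sections come under the integral. *)
Lemma product_preserving_left (h : T -> R) :
  measurable_fun setT h ->
  measure_preserving (lam \x m)%E
    (fun p => ((p.1 + h p.2 : measurableTypeR R), p.2)).
Proof.
move=> mh.
have mF : measurable_fun setT
    (fun p : measurableTypeR R * T => ((p.1 + h p.2 : measurableTypeR R), p.2)).
  apply/measurable_fun_pair; last exact: measurable_snd.
  apply: measurable_funD; first exact: measurable_fst.
  by apply: (measurableT_comp mh); exact: measurable_snd.
split=> // A mA.
have E B : measurable B -> (lam \x m)%E B = (lam \x^ m)%E B.
  apply: product_measure_unique => A1 A2 mA1 mA2.
  exact: product_measure2E.
rewrite !E//; last by rewrite -[X in measurable X]setTI; exact: mF.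
apply: eq_integral => y _ /=.
rewrite -[RHS](lebesgue_measure_translate (h y)); last exact: measurable_ysection.
by congr (lebesgue_measure _); apply/seteqP; split=> x /=; rewrite /ysection/= !inE.
Qed.

End product.

(** Transport along [tuple_cons], the map by which [lebesgue_tuple] is defined as a pushforward. *)
Lemma lebesgue_tuple_preserving n f F :
  (forall p, f (@tuple_cons R n p) = tuple_cons (F p)) ->
  measure_preserving (@lebesgue_measure R \x leb n)%E F ->
  measurable_fun setT f -> measure_preserving (leb n.+1) f.
Proof.
move=> fF [mF pF] mf; split => // A mA.
transitivity ((@lebesgue_measure R \x leb n)%E (F @^-1` (@tuple_cons R n @^-1` A))).
  rewrite [LHS]/=/lebesgue_tupleS /pushforward; congr (_ _).
  by apply/seteqP; split=> p /=; rewrite fF.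
rewrite pF//; rewrite -[X in measurable X]setTI; exact: measurable_tuple_cons.
Qed.

Definition shift n (i : 'I_n) (c : R) (x : n.-tuple R) : n.-tuple R :=
  [tuple tnth x k + (k == i)%:R * c | k < n].

Definition shear n (i j : 'I_n) (t : R) (x : n.-tuple R) : n.-tuple R :=
  shift i (t * tnth x j) x.

Lemma measurable_shear n (i j : 'I_n) t : measurable_fun setT (shear i j t).
Proof.
apply/measurable_fun_tnthP => k.
rewrite (_ : _ \o _ = fun x => tnth x k + (k == i)%:R * (t * tnth x j)).
  apply: measurable_funD; first exact: measurable_tnth.
  apply: measurable_funM; first exact: measurable_cst.
  by apply: measurable_funM; [exact: measurable_cst|exact: measurable_tnth].
by apply/funext => x; rewrite /= tnth_mktuple.
Qed.

Lemma measurable_shift n (i : 'I_n) c : measurable_fun setT (shift i c).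
Proof.
apply/measurable_fun_tnthP => k.
rewrite (_ : _ \o _ = fun x => tnth x k + (k == i)%:R * c).
  apply: measurable_funD; first exact: measurable_tnth.
  exact: measurable_cst.
by apply/funext => x; rewrite /= tnth_mktuple.
Qed.

Lemma shift_cons0 n c (p : measurableTypeR R * n.-tuple R) :
  shift ord0 c (tuple_cons p) = tuple_cons ((p.1 + c : measurableTypeR R), p.2).
Proof.
apply: eq_from_tnth => k; rewrite tnth_mktuple.
case: (unliftP ord0 k) => [k' ->|->].
  by rewrite !tnthS (_ : _ == _ = false) ?mul0r ?addr0.
by rewrite !tnth0 eqxx mul1r.
Qed.

Lemma shift_consS n (i : 'I_n) c (p : measurableTypeR R * n.-tuple R) :
  shift (lift ord0 i) c (tuple_cons p) = tuple_cons (p.1, shift i c p.2).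
Proof.
apply: eq_from_tnth => k; rewrite tnth_mktuple.
case: (unliftP ord0 k) => [k' ->|->].
  by rewrite !tnthS tnth_mktuple (inj_eq lift_inj).
by rewrite !tnth0 (_ : _ == _ = false) ?mul0r ?addr0.
Qed.

Lemma shift_preserving n (i : 'I_n) c : measure_preserving (leb n) (shift i c).
Proof.
elim: n i c => [[//]|n IH] i c.
case: (unliftP ord0 i) => [i' ->|->].
  apply: (lebesgue_tuple_preserving (shift_consS i' c)); last exact: measurable_shift.
  apply: (product_preserving_right (g := fun _ => shift i' c)) => //.
  apply/measurable_fun_pair; first exact: measurable_fst.
  by apply: (measurableT_comp (measurable_shift i' c)); exact: measurable_snd.
apply: (lebesgue_tuple_preserving (shift_cons0 c)); last exact: measurable_shift.
by apply: (@product_preserving_left _ _ _ (fun _ => c)); exact: measurable_cst.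
Qed.

(** Induction on the dimension. If neither index is 0, the shear acts on the tail; if $j=0$, it
    shifts the tail by an amount that depends on the head; if $i=0$, it translates the head by an
    amount that depends on the tail. *)
Lemma shear_preserving n (i j : 'I_n) t :
  i != j -> measure_preserving (leb n) (shear i j t).
Proof.
elim: n i j => [[//]|n IH] i j.
case: (unliftP ord0 i) => [i' ->|->]; case: (unliftP ord0 j) => [j' ->|->] ij //.
- rewrite (inj_eq lift_inj) in ij.
  apply: (@lebesgue_tuple_preserving _ _ (fun p => (p.1, shear i' j' t p.2))).
  + by move=> p; rewrite /shear shift_consS tnthS.
  + apply: (product_preserving_right (g := fun _ => shear i' j' t)).
      by move=> _; exact: IH.
    apply/measurable_fun_pair; first exact: measurable_fst.
    by apply: (measurableT_comp (measurable_shear i' j' t)); exact: measurable_snd.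
  + exact: measurable_shear.
- apply: (@lebesgue_tuple_preserving _ _ (fun p => (p.1, shift i' (t * p.1) p.2))).
  + by move=> p; rewrite /shear shift_consS tnth0.
  + apply: (product_preserving_right (g := fun x => shift i' (t * x))).
      by move=> x; exact: shift_preserving.
    apply/measurable_fun_pair; first exact: measurable_fst.
    apply/measurable_fun_tnthP => k.
    rewrite (_ : _ \o _ = fun p : measurableTypeR R * _ =>
        tnth p.2 k + (k == i')%:R * (t * p.1)); last first.
      by apply/funext => p; rewrite /= tnth_mktuple.
    apply: measurable_funD.
      by apply: (measurableT_comp (measurable_tnth _)); exact: measurable_snd.
    apply: measurable_funM; first exact: measurable_cst.
    by apply: measurable_funM; [exact: measurable_cst|exact: measurable_fst].
  + exact: measurable_shear.
- apply: (@lebesgue_tuple_preserving _ _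
    (fun p => ((p.1 + t * tnth p.2 j' : measurableTypeR R), p.2))).
  + by move=> p; rewrite /shear shift_cons0 tnthS.
  + apply: (@product_preserving_left _ _ _ (fun y => t * tnth y j')).
    by apply: measurable_funM; [exact: measurable_cst|exact: measurable_tnth].
  + exact: measurable_shear.
Qed.

End shears.

(** * Rotation invariance of the surface measure *)

Section rotations.
Context (R : realType) (d : nat).
Implicit Types x : d.-tuple R.
Local Notation sigma := (@surface_measure R d).

(* t is the tangent of half the angle of rotation in the (i, j)-plane. *)
Definition rotation (i j : 'I_d) (t : R) : d.-tuple R -> d.-tuple R :=
  shear i j (- t) \o shear j i (t *+ 2 / (1 + t ^+ 2)) \o shear i j (- t).

(** With $t=\tan(\theta/2)$ one has $(1-t^2)/(1+t^2)=\cos\theta$ and $2t/(1+t^2)=\sin\theta$, so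
    these are the usual formulas for the rotation by $\theta$. *)
Lemma tnth_rotation i j t x k : i != j -> tnth (rotation i j t x) k =
  if k == i then ((1 - t ^+ 2) * tnth x i - t *+ 2 * tnth x j) / (1 + t ^+ 2)
  else if k == j then ((1 - t ^+ 2) * tnth x j + t *+ 2 * tnth x i) / (1 + t ^+ 2)
  else tnth x k.
Proof.
move=> ij; have ji : (j == i) = false by rewrite eq_sym; apply/negbTE.
have t0 : 1 + t ^+ 2 != 0 by rewrite gt_eqF// ltr_pwDl// sqr_ge0.
rewrite /rotation/= /shear /shift !tnth_mktuple !eqxx ji.
have [->|ki] := eqVneq k i; first by rewrite ?eqxx (negbTE ij) !mul1r !mul0r; field.
have [->|kj] := eqVneq k j; first by rewrite ?eqxx ?ji !mul1r !mul0r; field.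
by rewrite !mul0r !addr0.
Qed.

Lemma enorm_rotation i j t x : i != j -> enorm (rotation i j t x) = enorm x.
Proof.
move=> ij; congr Num.sqrt.
have ji : j != i by rewrite eq_sym.
rewrite (bigD1 i)//= (bigD1 j)//= [RHS](bigD1 i)//= [X in _ = _ + X](bigD1 j)//=.
rewrite !tnth_rotation// !eqxx (negbTE ji) !addrA /=; congr (_ + _).
  have t0 : 1 + t ^+ 2 != 0 by rewrite gt_eqF// ltr_pwDl// sqr_ge0.
  by field.
apply: eq_bigr => k /andP[ki kj].
by rewrite tnth_rotation// (negbTE ki) (negbTE kj).
Qed.

Lemma normalize_rotation i j t x : i != j ->
  normalize (rotation i j t x) = rotation i j t (normalize x).
Proof.
move=> ij; apply: eq_from_tnth => k.
rewrite tnth_mktuple enorm_rotation// !tnth_rotation// !tnth_mktuple.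
by case: ifP => _; [ring|case: ifP => _ //; ring].
Qed.

Lemma rotation_lebesgue_preserving i j t :
  i != j -> measure_preserving (lebesgue_tuple R d) (rotation i j t).
Proof.
move=> ij; do !apply: measure_preserving_comp; apply: shear_preserving => //.
by rewrite eq_sym.
Qed.

(** Rotations keep the norm and commute with [normalize], so the cone over a preimage is the
    preimage of the cone, and invariance of Lebesgue measure applies. *)
Lemma rotation_preserving i j t : i != j -> measure_preserving sigma (rotation i j t).
Proof.
move=> ij; have [mr pr] := rotation_lebesgue_preserving t ij; split=> // A mA.
rewrite /surface_measure -[in RHS]pr.
  congr (_ * lebesgue_tuple _ _ _)%E; apply/seteqP.
  by split=> x; rewrite /cone/= normalize_rotation// /punctured_ball/= enorm_rotation.
apply: measurableI; last exact: measurable_punctured_ball.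
by rewrite -[X in measurable X]setTI; exact: measurable_normalize.
Qed.

Lemma measurable_sphere : measurable (@sphere R d).
Proof.
rewrite (_ : @sphere R d = @enorm R d @^-1` [set 1]).
  by rewrite -[X in measurable X]setTI; exact: measurable_enorm.
by apply/seteqP; split.
Qed.

Lemma Rintegral_rotation i j t (f : d.-tuple R -> R) : i != j ->
  measurable_fun setT f ->
  sigma.-integrable (@sphere R d) (EFin \o f \o rotation i j t) ->
  \int[sigma]_(x in @sphere R d) (f (rotation i j t x)) =
  \int[sigma]_(x in @sphere R d) f x.
Proof.
move=> ij mf intf; have [mr pr] := rotation_preserving t ij.
have E : rotation i j t @^-1` (@sphere R d) = @sphere R d.
  by apply/seteqP; split=> x; rewrite /sphere/= enorm_rotation.
rewrite /Rintegral; congr fine.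
transitivity (\int[pushforward sigma (rotation i j t)]_(x in @sphere R d) (f x)%:E)%E.
  rewrite integral_pushforward ?E//.
  - exact/measurable_EFinP.
  - exact: measurable_sphere.
apply: eq_measure_integral => A mA _; exact: pr.
Qed.

End rotations.

(** * The Casimir operator on polynomials *)

Section angular_momentum.
Context (F : comNzRingType) (d : nat).
Implicit Types p q : mpoly d F.

Definition var (i : 'I_d) : mpoly d F := mpolyX F (mnm1 i).

Definition angular (i j : 'I_d) p : mpoly d F :=
  var i * mderiv j p - var j * mderiv i p.

(** The sum runs over ordered pairs, so every coordinate plane counts twice; hence the factor 2 in
    the eigenvalues. *)
Definition casimir p : mpoly d F := \sum_i \sum_j angular i j (angular i j p).

Definition euler p : mpoly d F := \sum_i var i * mderiv i p.

Lemma mderiv_var i j : mderiv j (var i) = (i == j)%:R.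
Proof.
rewrite /var mderivX mnm1E; have [->|ij] := eqVneq i j; last by rewrite scale0r.
rewrite scale1r (_ : mnm_sub _ _ = mnm0); first by rewrite mpolyX0.
by apply/mnmP => k; rewrite mnmBE subnn mnmE.
Qed.

Lemma angularM i j p q : angular i j (p * q) = angular i j p * q + p * angular i j q.
Proof. by rewrite /angular !mderivM; ring. Qed.

Lemma angularD i j p q : angular i j (p + q) = angular i j p + angular i j q.
Proof. by rewrite /angular !mderivD; ring. Qed.

Lemma angular1 i j : angular i j 1 = 0.
Proof. by rewrite /angular -mpolyC1 !mderivC !mulr0 subr0. Qed.

Lemma angular_sqr i j p : angular i j (angular i j p) =
  (i == j)%:R * (var i * mderiv j p + var j * mderiv i p)
  + (var i ^+ 2 * mderiv j (mderiv j p) + var j ^+ 2 * mderiv i (mderiv i p))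
  - var i * mderiv i p - var j * mderiv j p
  - (var i * (var j * mderiv i (mderiv j p))) *+ 2.
Proof.
rewrite /angular !mderivB !mderivM !mderiv_var !eqxx (mderiv_comm j i) (eq_sym j i).
by rewrite !mulr1n; ring.
Qed.

(** Absorbs the mixed second derivatives of [angular_sqr] into powers of the Euler operator. *)
Lemma euler_euler p :
  euler (euler p) = euler p + \sum_i \sum_j var i * (var j * mderiv i (mderiv j p)).
Proof.
rewrite /euler -big_split/=; apply: eq_bigr => i _.
rewrite raddf_sum/= mulr_sumr.
have E j : var i * mderiv i (var j * mderiv j p) =
    var i * ((j == i)%:R * mderiv j p) + var i * (var j * mderiv i (mderiv j p)).
  by rewrite mderivM mderiv_var mulrDr.
rewrite (eq_bigr _ (fun j _ => E j)) big_split/=; congr (_ + _).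
rewrite (bigD1 i)//= eqxx mul1r big1 ?addr0//.
by move=> j ji; rewrite (negbTE ji) mul0r mulr0.
Qed.

Lemma sum_delta (G : 'I_d -> 'I_d -> mpoly d F) :
  \sum_i \sum_j (i == j)%:R * G i j = \sum_i G i i.
Proof.
apply: eq_bigr => i _; rewrite (bigD1 i)//= eqxx mul1r big1 ?addr0// => j ji.
by rewrite eq_sym (negbTE ji) mul0r.
Qed.

(** With $E$ the Euler operator this is $2(|x|^2\Delta-E^2-(d-2)E)$, arranged to avoid the natural
    subtraction $d-2$. *)
Lemma casimirE p : casimir p =
  ((\sum_i var i ^+ 2) * (\sum_i mderiv i (mderiv i p))) *+ 2
  + euler p *+ 4 - euler p *+ (2 * d) - euler (euler p) *+ 2.
Proof.
rewrite euler_euler /casimir.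
under eq_bigr => i _ do under eq_bigr => j _ do rewrite angular_sqr.
under eq_bigr => i _ do rewrite !sumrB !big_split/=.
rewrite !sumrB !big_split/= sum_delta/= big_split/=.
have E1 : \sum_i \sum_j var i ^+ 2 * mderiv j (mderiv j p) =
    (\sum_i var i ^+ 2) * (\sum_i mderiv i (mderiv i p)).
  by rewrite mulr_suml; apply: eq_bigr => i _; rewrite mulr_sumr.
have E2 : \sum_i \sum_j var j ^+ 2 * mderiv i (mderiv i p) =
    (\sum_i var i ^+ 2) * (\sum_i mderiv i (mderiv i p)).
  by rewrite exchange_big E1.
have E3 : \sum_(i < d) \sum_(j < d) var i * mderiv i p = euler p *+ d.
  rewrite /euler -sumrMnl; apply: eq_bigr => i _.
  by rewrite sumr_const card_ord.
have E4 : \sum_(i < d) \sum_(j < d) var j * mderiv j p = euler p *+ d.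
  by rewrite exchange_big E3.
rewrite E1 E2 E3 E4 -/(euler p) mulnC mulrnA.
set S := \sum_i \sum_j _; set a := _ * _; set e := euler p.
by rewrite !mulrnDl; set ed := e *+ d; ring.
Qed.

Lemma euler_homog m p : p \is ishomog1 m mdeg -> euler p = p *+ m.
Proof.
move=> /dhomogP hp.
rewrite [in LHS](mpolyE p) [in RHS](mpolyE p) -sumrMnl /euler.
under eq_bigr => i _ do rewrite raddf_sum/= mulr_sumr.
rewrite exchange_big/= [LHS]big_seq [RHS]big_seq; apply: eq_bigr => u up.
transitivity (\sum_(i < d) (mcoeff u p *: mpolyX F u) *+ u i); last first.
  by have <- : mdeg u = m := hp u up; rewrite mdegE -sumrMnr.
apply: eq_bigr => i _; rewrite mderivZ mderivX -!scalerAr scalerMnr; congr (_ *: _).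
(* The exponent $u-e_i$ is a truncated subtraction, faithful only if $u_i>0$; if $u_i=0$, the factor
   $u_i$ kills the term. *)
rewrite scaler_nat; have [->|ui] := eqVneq (u i) 0; first by rewrite !mulr0n.
congr (_ *+ _); rewrite /var -mpolyXD; congr mpolyX.
rewrite addmC submK//; apply/mnm_lepP => l; rewrite mnm1E.
by case: eqP => // <-; rewrite lt0n.
Qed.

(** The Laplacian term vanishes and the Euler operator acts as $m$, which leaves the eigenvalue
    $4m-2m(m+d)=-2m(m+d-2)$. *)
Lemma casimir_harmonic m p : p \is ishomog1 m mdeg ->
  \sum_i mderiv i (mderiv i p) = 0 ->
  casimir p = p *+ (4 * m) - p *+ (2 * (m * (m + d))).
Proof.
move=> hp lp; rewrite casimirE lp mulr0 mul0rn add0r.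
have e := euler_homog hp.
have ee : euler (euler p) = p *+ (m * m).
  rewrite e {1}/euler; under eq_bigr => i _ do rewrite mderivMn mulrnAr.
  by rewrite sumrMnl -/(euler p) e mulrnA.
rewrite ee e -!mulrnA -addrA -opprD -mulrnDr; congr (_ *+ _ - _ *+ _); lia.
Qed.

End angular_momentum.

(** * Rotated polynomials as polynomials in the half-angle tangent *)

Section rotation_expansion.
Context (F : comNzRingType) (d : nat) (i j : 'I_d).
Hypothesis ij : i != j.

(** The action of a rotation as a relation, with the denominator $1+t^2$ cleared so that no division
    in [F] is needed. *)
Definition rotated (t : F) (v w : 'I_d -> F) :=
  [/\ (1 + t ^+ 2) * w i = (1 - t ^+ 2) * v i - t *+ 2 * v j,
      (1 + t ^+ 2) * w j = (1 - t ^+ 2) * v j + t *+ 2 * v i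
    & forall k, k != i -> k != j -> w k = v k].

(** The rotated $p$, times $(1+t^2)^m$, is a polynomial in $t$ whose coefficients are polynomials in
    the point. The linear one has a factor 2 because the angle is $2t$ to first order. *)
Definition rotation_expansion (m : nat) (p : mpoly d F) (G : {poly mpoly d F}) :=
  [/\ forall t v w, rotated t v w ->
        (1 + t ^+ 2) ^+ m * meval w p = (map_poly (meval v) G).[t],
      G`_0 = p & G`_1 = angular i j p *+ 2].

(** The linear coefficient of a product matches because [angular] is a derivation. *)
Lemma rotation_expansionM m n p q G H :
  rotation_expansion m p G -> rotation_expansion n q H ->
  rotation_expansion (m + n) (p * q) (G * H).
Proof.
move=> [e0 e1 e2] [f0 f1 f2]; split.
- move=> t v w r; rewrite mevalM rmorphM hornerM -(e0 _ _ _ r) -(f0 _ _ _ r) exprD.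
  by ring.
- by rewrite coefM big_ord_recl big_ord0 /= e1 f1 addr0.
- rewrite coefM !big_ord_recl big_ord0 /= /bump/= subn0 subnn e1 e2 f1 f2 angularM.
  by ring.
Qed.

Lemma rotation_expansionD m p q G H :
  rotation_expansion m p G -> rotation_expansion m q H ->
  rotation_expansion m (p + q) (G + H).
Proof.
move=> [e0 e1 e2] [f0 f1 f2]; split.
- by move=> t v w r; rewrite mevalD rmorphD hornerD -(e0 _ _ _ r) -(f0 _ _ _ r) mulrDr.
- by rewrite coefD e1 f1.
- by rewrite coefD e2 f2 angularD; ring.
Qed.

Lemma rotation_expansionC c : rotation_expansion 0 (mpolyC d c) (mpolyC d c)%:P.
Proof.
split; [move=> t v w _|by rewrite coefC|].
  by rewrite map_polyC hornerC expr0 mul1r /= !mevalC.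
by rewrite coefC/= /angular !mderivC !mulr0 subr0 mul0rn.
Qed.

(** The factor $1+t^2$ has constant term 1 and no linear term, so it leaves the two lowest
    coefficients alone. Raising exponents brings summands to a common one. *)
Lemma rotation_expansion_raise m p :
  (exists G, rotation_expansion m p G) -> exists G, rotation_expansion m.+1 p G.
Proof.
move=> [G e]; exists (G * (1 + 'X ^+ 2)); rewrite -addn1 -[p]mulr1.
apply: rotation_expansionM => //; split.
- move=> t v w _; rewrite expr1 meval1 mulr1 rmorphD rmorph1 rmorphXn/= map_polyX.
  by rewrite !hornerE.
- by rewrite coefD coef1 coefXn addr0.
- by rewrite coefD coef1 coefXn addr0 angular1 mul0rn.
Qed.

Lemma rotation_expansion_var k : exists G, rotation_expansion 1 (var F k) G.
Proof.
have ji : j != i by rewrite eq_sym.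
have [->{k}|ki] := eqVneq k i.
  exists ((var F i)%:P * (1 - 'X ^+ 2) - (var F j)%:P * ('X *+ 2)); split.
  - move=> t v w [e _ _]; rewrite expr1 /var mevalXU e.
    rewrite rmorphB !rmorphM rmorphB rmorph1 rmorphXn rmorphMn/= map_polyX.
    by rewrite !map_polyC/= !mevalXU !hornerE; ring.
  - rewrite coefB !coefCM coefB coef1 coefXn coefMn coefX /= !mulr1n !mulr0n; ring.
  - rewrite coefB !coefCM coefB coef1 coefXn coefMn coefX /= !mulr1n !mulr0n /angular.
    by rewrite !mderiv_var eqxx (negbTE ij) /= !mulr1n !mulr0n; ring.
have [->{k ki}|kj] := eqVneq k j.
  exists ((var F j)%:P * (1 - 'X ^+ 2) + (var F i)%:P * ('X *+ 2)); split.
  - move=> t v w [_ e _]; rewrite expr1 /var mevalXU e.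
    rewrite rmorphD !rmorphM rmorphB rmorph1 rmorphXn rmorphMn/= map_polyX.
    by rewrite !map_polyC/= !mevalXU !hornerE; ring.
  - by rewrite coefD !coefCM coefB coef1 coefXn coefMn coefX /= !mulr1n !mulr0n; ring.
  - rewrite coefD !coefCM coefB coef1 coefXn coefMn coefX /= !mulr1n !mulr0n /angular.
    by rewrite !mderiv_var eqxx (negbTE ji) /= !mulr1n !mulr0n; ring.
apply: rotation_expansion_raise; exists (var F k)%:P; split.
- by move=> t v w [_ _ e]; rewrite map_polyC hornerC expr0 mul1r /= /var !mevalXU e.
- by rewrite coefC.
- by rewrite coefC/= /angular !mderiv_var (negbTE ki) (negbTE kj) !mulr0 subr0 mul0rn.
Qed.

(** Monomials are products of constants and variables; a sum is formed after both summands are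
    raised to the exponent [m + n]. *)
Lemma rotation_expansion_exists p : exists m G, rotation_expansion m p G.
Proof.
have lift m n q : (m <= n)%N -> (exists G, rotation_expansion m q G) ->
    exists G, rotation_expansion n q G.
  move=> /subnK <-; elim: (n - m)%N => // k IH e.
  by apply: rotation_expansion_raise; exact: IH.
elim/mpolyind: p => [|c u p _ _ [m [G e]]].
  exists 0%N, (mpolyC d 0)%:P; rewrite -[X in rotation_expansion _ X]mpolyC0.
  exact: rotation_expansionC.
have [n [H f]] : exists n H, rotation_expansion n (c *: mpolyX F u) H.
  suff [n [H f]] : exists n H, rotation_expansion n (mpolyX F u) H.
    exists (0 + n)%N, ((mpolyC d c)%:P * H); rewrite -mul_mpolyC.
    by apply: rotation_expansionM => //; exact: rotation_expansionC.
  rewrite mpolyXE_id; elim/big_ind: _ => [|q r [n [H f]] [n' [H' f']]|k _].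
  - exists 0%N, (mpolyC d 1)%:P; rewrite -mpolyC1; exact: rotation_expansionC.
  - by exists (n + n')%N, (H * H'); exact: rotation_expansionM.
  - elim: (u k) => [|l [n [H f]]].
      by exists 0%N, (mpolyC d 1)%:P; rewrite expr0 -mpolyC1; exact: rotation_expansionC.
    have [H' f'] := rotation_expansion_var k.
    by exists (1 + n)%N, (H' * H); rewrite exprS; exact: rotation_expansionM.
have [G' e'] : exists G, rotation_expansion (m + n) p G.
  by apply: (lift m); [exact: leq_addr|exists G].
have [H' f'] : exists G, rotation_expansion (m + n) (c *: mpolyX F u) G.
  by apply: (lift n); [exact: leq_addl|exists H].
by exists (m + n)%N, (H' + G'); exact: rotation_expansionD.
Qed.

End rotation_expansion.

(** * Real-valued modulus, real and imaginary parts *)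

Section complex_arith.
Context (R : realType).
Implicit Types x y : R[i].
Local Notation Re := (@complex.Re R).
Local Notation Im := (@complex.Im R).
Local Notation normc := (@ComplexField.Normc.normc R).

Lemma complex_ReM x y : Re (x * y) = Re x * Re y - Im x * Im y.
Proof. by case: x => a b; case: y. Qed.

Lemma complex_ImM x y : Im (x * y) = Re x * Im y + Im x * Re y.
Proof. by case: x => a b; case: y. Qed.

Lemma complex_ReD x y : Re (x + y) = Re x + Re y.
Proof. by case: x => a b; case: y. Qed.

Lemma complex_ImD x y : Im (x + y) = Im x + Im y.
Proof. by case: x => a b; case: y. Qed.

Lemma normc_ge0 x : 0 <= normc x.
Proof. by case: x => a b; rewrite sqrtr_ge0. Qed.

Lemma ler_Re_normc x : `|Re x| <= normc x.
Proof.
by case: x => a b /=; rewrite -sqrtr_sqr ler_wsqrtr// lerDl sqr_ge0.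
Qed.

Lemma ler_Im_normc x : `|Im x| <= normc x.
Proof.
by case: x => a b /=; rewrite -sqrtr_sqr ler_wsqrtr// lerDr sqr_ge0.
Qed.

Lemma ler_normc_ReIm x : normc x <= `|Re x| + `|Im x|.
Proof.
case: x => a b /=; rewrite -[leRHS]ger0_norm ?addr_ge0// -sqrtr_sqr ler_wsqrtr//.
rewrite -(real_normK (num_real a)) -(real_normK (num_real b)).
have := normr_ge0 a; have := normr_ge0 b; nra.
Qed.

Lemma normc_conj x : normc x^* = normc x.
Proof. by case: x => a b /=; rewrite sqrrN. Qed.

Lemma normc_real (r : R) : normc r%:C = `|r|.
Proof. by rewrite /= expr0n addr0 sqrtr_sqr. Qed.

Lemma ler_normc_sum (I : Type) (s : seq I) (P : pred I) (F : I -> R[i]) :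
  normc (\sum_(i <- s | P i) F i) <= \sum_(i <- s | P i) normc (F i).
Proof.
elim/big_rec2: _ => [|i x y _ xy]; first by rewrite ComplexField.Normc.normc0.
by apply: le_trans (le_normcD _ _) _; rewrite lerD2l.
Qed.

End complex_arith.

(** * Integrals of bounded functions over the sphere *)

Section bounded_measurable.
Context (R : realType) (d : nat).
Local Notation tup := (d.-tuple R).
Local Notation sigma := (@surface_measure R d).
Local Notation S := (@sphere R d).
Local Notation Re := (@complex.Re R).
Local Notation Im := (@complex.Im R).
Local Notation normc := (@ComplexField.Normc.normc R).
Implicit Types f g : tup -> R[i].

(** The bound is asked on the sphere only, since polynomials are unbounded on the whole space. *)
Definition bounded_measurable f :=
  [/\ measurable_fun setT (fun x => Re (f x)),
      measurable_fun setT (fun x => Im (f x))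
    & exists M, forall x, S x -> normc (f x) <= M].

Lemma bounded_measurable_cst c : bounded_measurable (fun _ => c).
Proof. by split; [exact: measurable_cst|exact: measurable_cst|exists (normc c)]. Qed.

Lemma bounded_measurableD f g : bounded_measurable f -> bounded_measurable g ->
  bounded_measurable (fun x => f x + g x).
Proof.
move=> [f1 f2 [M fM]] [g1 g2 [N gN]]; split.
- by under eq_fun do rewrite complex_ReD; exact: measurable_funD.
- by under eq_fun do rewrite complex_ImD; exact: measurable_funD.
- exists (M + N) => x Sx; apply: le_trans (le_normcD _ _) _.
  by rewrite lerD ?fM ?gN.
Qed.

Lemma bounded_measurableM f g : bounded_measurable f -> bounded_measurable g ->
  bounded_measurable (fun x => f x * g x).
Proof.
move=> [f1 f2 [M fM]] [g1 g2 [N gN]]; split.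
- under eq_fun do rewrite complex_ReM.
  by apply: measurable_funB; exact: measurable_funM.
- under eq_fun do rewrite complex_ImM.
  by apply: measurable_funD; exact: measurable_funM.
- exists (M * N) => x Sx; rewrite ComplexField.Normc.normcM.
  by rewrite ler_pM ?normc_ge0 ?fM ?gN.
Qed.

Lemma bounded_measurable_conj f : bounded_measurable f ->
  bounded_measurable (fun x => (f x)^*).
Proof.
move=> [f1 f2 [M fM]]; split.
- rewrite (_ : (fun x => _) = fun x => Re (f x))//.
  by apply/funext => x; case: (f x).
- rewrite (_ : (fun x => _) = (fun x => - Im (f x))); first exact: measurable_funN.
  by apply/funext => x; case: (f x).
- by exists M => x Sx; rewrite normc_conj fM.
Qed.

Lemma bounded_measurable_coord i : bounded_measurable (fun x => (tnth x i)%:C).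
Proof.
split; [exact: measurable_tnth|exact: measurable_cst|exists 1 => x Sx].
rewrite normc_real -sqrtr_sqr -[leRHS]Sx ler_wsqrtr//.
rewrite (bigD1 i)//= lerDl sumr_ge0// => k _; exact: sqr_ge0.
Qed.

Definition ev (p : mpoly d R[i]) (x : tup) : R[i] :=
  meval (fun i => (tnth x i)%:C) p.

Lemma evD p q x : ev (p + q) x = ev p x + ev q x.
Proof. exact: mevalD. Qed.

Lemma evM p q x : ev (p * q) x = ev p x * ev q x.
Proof. exact: mevalM. Qed.

Lemma evZ c p x : ev (c *: p) x = c * ev p x.
Proof. exact: mevalZ. Qed.

Lemma bounded_measurable_ev p : bounded_measurable (ev p).
Proof.
elim/mpolyind: p => [|c u p _ _ IH].
  rewrite (_ : ev 0 = fun=> 0); first exact: bounded_measurable_cst.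
  by apply/funext => x; exact: meval0.
rewrite (_ : ev _ = fun x => c * ev (mpolyX _ u) x + ev p x); last first.
  by apply/funext => x; rewrite evD evZ.
apply: bounded_measurableD => //; apply: bounded_measurableM.
  exact: bounded_measurable_cst.
rewrite (_ : ev _ = fun x => \prod_(i < d) (tnth x i)%:C ^+ u i); last first.
  by apply/funext => x; exact: mevalX.
elim: (index_enum _) => [|i s IHs].
  by under eq_fun do rewrite big_nil; exact: bounded_measurable_cst.
under eq_fun do rewrite big_cons.
apply: bounded_measurableM => //; elim: (u i) => [|n IHn].
  by under eq_fun do rewrite expr0; exact: bounded_measurable_cst.
under eq_fun do rewrite exprS.
by apply: bounded_measurableM => //; exact: bounded_measurable_coord.
Qed.

Lemma measurable_normc f : bounded_measurable f ->
  measurable_fun setT (fun x => normc (f x)).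
Proof.
move=> [f1 f2 _].
rewrite (_ : (fun x => _) = (@powR R ^~ 2^-1) \o (fun x => Re (f x) ^+ 2 + Im (f x) ^+ 2)).
  apply: measurableT_comp; first exact: measurable_powR.
  by apply: measurable_funD; exact: measurable_funX.
apply/funext => x /=; rewrite powR12_sqrt ?addr_ge0 ?sqr_ge0//.
by case: (f x).
Qed.

Hypothesis finS : (sigma S < +oo)%E.

(** Uses that the sphere has finite measure, a hypothesis that [surface_area_neq0] later
    supplies. *)
Lemma integrable_bounded (h : tup -> R) M : measurable_fun setT h ->
  (forall x, S x -> `|h x| <= M) -> sigma.-integrable S (EFin \o h).
Proof.
move=> mh hM; apply: measurable_bounded_integrable => //.
- exact: measurable_sphere.
- exact: measurable_funTS.
- exists M; split; first exact: num_real.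
  by move=> N MN x Sx; apply: le_trans (ltW MN); exact: hM.
Qed.

Lemma integrable_Re f : bounded_measurable f -> sigma.-integrable S (EFin \o (fun x => Re (f x))).
Proof.
move=> [f1 _ [M fM]]; apply: (integrable_bounded (M := M)) => // x Sx.
by apply: le_trans (ler_Re_normc _) _; exact: fM.
Qed.

Lemma integrable_Im f : bounded_measurable f -> sigma.-integrable S (EFin \o (fun x => Im (f x))).
Proof.
move=> [_ f1 [M fM]]; apply: (integrable_bounded (M := M)) => // x Sx.
by apply: le_trans (ler_Im_normc _) _; exact: fM.
Qed.

Lemma integrable_normc f : bounded_measurable f ->
  sigma.-integrable S (EFin \o (fun x => normc (f x))).
Proof.
move=> bf; have [_ _ [M fM]] := bf; apply: (integrable_bounded (M := M)).
  exact: measurable_normc.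
by move=> x Sx; rewrite ger0_norm ?normc_ge0 ?fM.
Qed.

Lemma eq_sphere_integral f g : (forall x, S x -> f x = g x) ->
  sphere_integral f = sphere_integral g.
Proof.
move=> fg; rewrite /sphere_integral; congr (_ +i* _);
by apply: eq_Rintegral => x; rewrite inE => Sx; rewrite fg.
Qed.

Lemma sphere_integralD f g : bounded_measurable f -> bounded_measurable g ->
  sphere_integral (fun x => f x + g x) = sphere_integral f + sphere_integral g.
Proof.
move=> bf bg; have mS := @measurable_sphere R d; rewrite /sphere_integral.
under eq_Rintegral do rewrite complex_ReD.
rewrite RintegralD//; [|exact: integrable_Re..].
under [X in _ +i* X]eq_Rintegral do rewrite complex_ImD.
by rewrite RintegralD//; exact: integrable_Im.
Qed.

Lemma sphere_integralZ c f : bounded_measurable f ->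
  sphere_integral (fun x => c * f x) = c * sphere_integral f.
Proof.
move=> bf; have mS := @measurable_sphere R d; rewrite /sphere_integral.
have iR := integrable_Re bf; have iI := integrable_Im bf.
have Z (r : R) h : sigma.-integrable S (EFin \o h) ->
    sigma.-integrable S (EFin \o (fun x => r * h x)).
  move=> ih; rewrite (_ : EFin \o _ = (fun x => r%:E * (EFin \o h) x)%E).
    exact: integrableZl.
  by apply/funext => x; rewrite /= EFinM.
under eq_Rintegral do rewrite complex_ReM.
rewrite RintegralB//; [|exact: Z..].
under [X in _ +i* X]eq_Rintegral do rewrite complex_ImM.
rewrite RintegralD//; [|exact: Z..].
by rewrite !RintegralZl//; case: c.
Qed.

Lemma sphere_integral0 : sphere_integral (fun _ : tup => 0 : R[i]) = 0.
Proof.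
rewrite /sphere_integral/= Rintegral_cst; last exact: measurable_sphere.
by rewrite mul0r.
Qed.

Lemma sphere_integral_rotation i j t f : i != j -> bounded_measurable f ->
  bounded_measurable (fun x => f (rotation i j t x)) /\
  sphere_integral (fun x => f (rotation i j t x)) = sphere_integral f.
Proof.
move=> ij bf; have [mr pr] := rotation_preserving t ij.
have [f1 f2 [M fM]] := bf.
have b : bounded_measurable (fun x => f (rotation i j t x)).
  split.
  - exact: (measurableT_comp f1 mr).
  - exact: (measurableT_comp f2 mr).
  - by exists M => x Sx; apply: fM; rewrite /sphere/= enorm_rotation.
split=> //; rewrite /sphere_integral; congr (_ +i* _).
- apply: (Rintegral_rotation (f := fun x => Re (f x))) => //.
  exact: integrable_Re b.
- apply: (Rintegral_rotation (f := fun x => Im (f x))) => //.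
  exact: integrable_Im b.
Qed.

End bounded_measurable.

(** * Orthogonality of harmonics of different degrees *)

Section harmonic_orthogonality.
Context (R : realType) (d : nat).
Local Notation S := (@sphere R d).
Hypothesis finS : (surface_measure S < +oo)%E.
Implicit Types p q : mpoly d R[i].

Definition mpoly_integral p : R[i] := sphere_integral (ev p).
Local Notation I := mpoly_integral.

Lemma mpoly_integralD p q : I (p + q) = I p + I q.
Proof.
rewrite /I -sphere_integralD//; [|exact: bounded_measurable_ev..].
by apply: eq_sphere_integral => x _; exact: evD.
Qed.

Lemma mpoly_integralZ c p : I (c *: p) = c * I p.
Proof.
rewrite /I -sphere_integralZ//; last exact: bounded_measurable_ev.
by apply: eq_sphere_integral => x _; exact: evZ.
Qed.

Lemma mpoly_integral0 : I 0 = 0.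
Proof. by rewrite -[X in I X](scale0r 0) mpoly_integralZ mul0r. Qed.

Lemma mpoly_integralN p : I (- p) = - I p.
Proof. by rewrite -scaleN1r mpoly_integralZ mulN1r. Qed.

Lemma mpoly_integralMn p n : I (p *+ n) = I p *+ n.
Proof.
elim: n => [|n IH]; first by rewrite !mulr0n mpoly_integral0.
by rewrite !mulrS mpoly_integralD IH.
Qed.

Lemma mpoly_integral_sum (J : Type) (s : seq J) (P : pred J) (F : J -> mpoly d R[i]) :
  I (\sum_(j <- s | P j) F j) = \sum_(j <- s | P j) I (F j).
Proof.
elim/big_rec2: _ => [|j x y _ <-]; first exact: mpoly_integral0.
exact: mpoly_integralD.
Qed.

Lemma ev_sum (J : Type) (s : seq J) (P : pred J) (F : J -> mpoly d R[i]) x :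
  ev (\sum_(j <- s | P j) F j) x = \sum_(j <- s | P j) ev (F j) x.
Proof.
elim/big_rec2: _ => [|j y z _ <-]; first exact: meval0.
exact: evD.
Qed.

Lemma rotated_rotation i j (t : R) (x : d.-tuple R) : i != j ->
  rotated i j t%:C (fun k => (tnth x k)%:C) (fun k => (tnth (rotation i j t x) k)%:C).
Proof.
move=> ij.
have t0 : 1 + t ^+ 2 != 0 by rewrite gt_eqF// ltr_pwDl// sqr_ge0.
have E (y z : R) : (1 + t ^+ 2) * y = z -> (1 + t%:C ^+ 2) * y%:C = z%:C.
  by move=> <-; rewrite rmorphM rmorphD rmorph1 rmorphXn.
split => [||k ki kj].
- rewrite (E _ ((1 - t ^+ 2) * tnth x i - t *+ 2 * tnth x j)).
    by rewrite rmorphB !rmorphM rmorphB rmorph1 rmorphXn rmorphMn.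
  by rewrite tnth_rotation// eqxx mulrC divfK.
- rewrite (E _ ((1 - t ^+ 2) * tnth x j + t *+ 2 * tnth x i)).
    by rewrite rmorphD !rmorphM rmorphB rmorph1 rmorphXn rmorphMn.
  by rewrite tnth_rotation// eq_sym (negbTE ij) eqxx mulrC divfK.
- by rewrite tnth_rotation// (negbTE ki) (negbTE kj).
Qed.

(** A polynomial in $X^2$ has no linear term, so clearing denominators does not affect the linear
    coefficient in $t$. *)
Lemma coef1_sqrDX (m : nat) : ((1 + 'X ^+ 2) ^+ m : {poly R[i]})`_1 = 0.
Proof.
elim: m => [|m IH]; first by rewrite expr0 coef1.
by rewrite exprS mulrDl mul1r coefD IH mulrC coefMXn addr0.
Qed.

Lemma poly_eq0_real (Q : {poly R[i]}) : (forall t : R, Q.[t%:C] = 0) -> Q = 0.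
Proof.
(* The natural numbers below [size Q] are already more roots than the degree of a nonzero [Q]
   allows. *)
move=> Q0; apply: (@roots_geq_poly_eq0 _ _ [seq n%:R | n <- iota 0 (size Q)]).
- apply/allP => _ /mapP[n _ ->]; apply/eqP.
  by rewrite -(rmorph_nat (real_complex R)) Q0.
- rewrite map_inj_uniq ?iota_uniq// => m n /eqP; by rewrite eqr_nat => /eqP.
- by rewrite size_map size_iota.
Qed.

(* The linear coefficient in t of the invariance under the rotations of the (i, j)-plane. *)
Lemma mpoly_integral_angular i j p : I (angular i j p) = 0.
Proof.
have [->|ij] := eqVneq i j; first by rewrite /angular subrr mpoly_integral0.
have [m [G [e _ G1]]] := rotation_expansion_exists ij p.
(* The difference of the two sides of the invariance identity, as a polynomial in $t$. *)
pose Q := \poly_(k < size G) I G`_k - I p *: (1 + 'X ^+ 2) ^+ m.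
suff Q0 : Q = 0.
  have : Q`_1 = 0 by rewrite Q0 coef0.
  rewrite coefB coefZ coef1_sqrDX mulr0 subr0 coef_poly.
  (* If [size G] is at most 1, the linear coefficient of [G] is the default 0, which still equals
     twice [angular i j p]. *)
  case: ltnP => [_|/(nth_default 0) G10 _].
    by rewrite G1 mpoly_integralMn => /eqP; rewrite mulrn_eq0 => /eqP.
  have : I G`_1 = 0 by rewrite G10 mpoly_integral0.
  by rewrite G1 mpoly_integralMn => /eqP; rewrite mulrn_eq0 => /eqP.
apply: poly_eq0_real => t.
rewrite hornerD hornerN hornerZ horner_exp hornerD hornerXn hornerC horner_poly.
have [b r] := sphere_integral_rotation finS t ij (bounded_measurable_ev p).
(* By invariance [I p] is the integral of the rotated [p], to which the expansion in $t$ applies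
   pointwise. *)
have E : (1 + t%:C ^+ 2) ^+ m * I p = I (\sum_(k < size G) t%:C ^+ k *: G`_k).
  rewrite {1}/mpoly_integral -r.
  rewrite -(sphere_integralZ finS ((1 + t%:C ^+ 2) ^+ m) b).
  apply: eq_sphere_integral => x _.
  rewrite ev_sum [X in _ * X]/ev (e _ _ _ (rotated_rotation t x ij)).
  rewrite (horner_coef_wide _ (size_poly _ _)); apply: eq_bigr => k _.
  rewrite evZ mulrC; congr (_ * _).
  by rewrite coef_map_id0 ?meval0.
apply/eqP; rewrite subr_eq0 [X in _ == X]mulrC E mpoly_integral_sum; apply/eqP.
by apply: eq_bigr => k _; rewrite mpoly_integralZ mulrC.
Qed.

(** Integration by parts: [angular] is a derivation whose values have integral 0, hence
    antisymmetric, and its square is symmetric. *)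
Lemma casimir_symmetric p q : I (casimir p * q) = I (p * casimir q).
Proof.
rewrite /casimir mulr_suml mulr_sumr !mpoly_integral_sum; apply: eq_bigr => i _.
rewrite mulr_suml mulr_sumr !mpoly_integral_sum; apply: eq_bigr => j _.
have E1 : I (angular i j (angular i j p) * q) + I (angular i j p * angular i j q) = 0.
  by rewrite -mpoly_integralD -angularM mpoly_integral_angular.
have E2 : I (angular i j p * angular i j q) + I (p * angular i j (angular i j q)) = 0.
  by rewrite -mpoly_integralD -angularM mpoly_integral_angular.
by rewrite -(addr0_eq E2) -(addr0_eq E1) opprK.
Qed.

(** Both factors are eigenvectors of a symmetric operator, and their eigenvalues differ because
    $j\mapsto j(j+d-2)$ is strictly increasing for $d\ge2$. *)
Lemma mpoly_integral_harmonic j l p q : (2 <= d)%N -> j != l ->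
  p \is ishomog1 j mdeg -> laplacian p = 0 ->
  q \is ishomog1 l mdeg -> laplacian q = 0 -> I (p * q) = 0.
Proof.
move=> d2 jl hp lp hq lq; have := casimir_symmetric p q.
rewrite (casimir_harmonic hp lp) (casimir_harmonic hq lq) mulrBl mulrBr.
rewrite !mulrnAl !mulrnAr !mpoly_integralD !mpoly_integralN !mpoly_integralMn.
set z := I _ => E; apply/eqP; move: jl; apply: contraNT => z0.
(* The negative terms change sides, which turns the comparison of eigenvalues into one between
   natural numbers. *)
have {}E : z *+ (4 * j + 2 * (l * (l + d))) = z *+ (4 * l + 2 * (j * (j + d))).
  rewrite !mulrnDr; apply/eqP; rewrite -subr_eq0.
  by move/eqP: E; rewrite -subr_eq0; congr (_ == 0); ring.
have /eqP : z * (4 * j + 2 * (l * (l + d)))%N%:R = z * (4 * l + 2 * (j * (j + d)))%N%:R.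
  by rewrite !mulr_natr.
rewrite (inj_eq (mulfI z0)) eqr_nat => /eqP; clear -d2 => E.
apply/eqP; have [//|jl|jl] := ltngtP j l; nia.
Qed.

(** Conjugating coefficients conjugates the values at real points, so [inner] becomes the integral
    of one polynomial. Homogeneity and harmonicity survive. *)
Definition conj_mpoly p : mpoly d R[i] := map_mpoly (@conjc R) p.

Lemma ev_conj_mpoly p x : ev (conj_mpoly p) x = (ev p x)^*.
Proof.
elim/mpolyind: p => [|c u p _ _ IH].
  by rewrite /conj_mpoly raddf0 /ev meval0 conjc0.
rewrite /conj_mpoly raddfD/= map_mpolyZ map_mpolyX -/(conj_mpoly p) !evD !evZ.
rewrite IH rmorphD rmorphM/=; congr (_ * _ + _).
rewrite /ev !mevalX rmorph_prod; apply: eq_bigr => i _.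
by rewrite rmorphXn/= oppr0.
Qed.

Lemma mderiv_conj_mpoly i p : mderiv i (conj_mpoly p) = conj_mpoly (mderiv i p).
Proof.
apply/mpolyP => m.
rewrite mcoeff_mderiv !mcoeff_map_mpoly mcoeff_mderiv; exact/esym/rmorphMn.
Qed.

Lemma laplacian_conj_mpoly p : laplacian p = 0 -> laplacian (conj_mpoly p) = 0.
Proof.
move=> lp; rewrite /laplacian.
under eq_bigr do rewrite !mderiv_conj_mpoly.
by rewrite -raddf_sum -/(laplacian p) lp raddf0.
Qed.

Lemma homog_conj_mpoly m p : p \is ishomog1 m mdeg -> conj_mpoly p \is ishomog1 m mdeg.
Proof.
move=> /dhomogP hp; apply/dhomogP => u.
rewrite mcoeff_msupp mcoeff_map_mpoly => cu; apply: hp; rewrite mcoeff_msupp.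
by apply: contraNN cu => /eqP ->; apply/eqP; exact: conjc0.
Qed.

Lemma inner_ev p q : inner (ev p) (ev q) = I (p * conj_mpoly q).
Proof. by apply: eq_sphere_integral => x _; rewrite evM ev_conj_mpoly. Qed.

End harmonic_orthogonality.

(** * Uniqueness of the coefficients of a single expansion *)

Lemma integrable_nneseries d (T : measurableType d) (R : realType)
    (mu : {measure set T -> \bar R}) (D : set T) (F : nat -> T -> \bar R) :
  measurable D -> (forall j, measurable_fun D (F j)) ->
  (forall j x, D x -> (0 <= F j x)%E) ->
  (\sum_(0 <= j <oo) \int[mu]_(x in D) F j x < +oo)%E ->
  mu.-integrable D (fun x => \sum_(0 <= j <oo) F j x)%E.
Proof.
move=> mD mF F0 Foo; apply/integrableP; split.
  rewrite (_ : (fun x => _) = (fun x => \sum_(0 <= j <oo | j \in xpredT) F j x)%E).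
    by apply: ge0_emeasurable_sum => // k x Dx _; exact: F0.
  by apply/funext => x; apply: eq_eseriesl.
rewrite (eq_integral (fun x => \sum_(0 <= j <oo) F j x)%E); last first.
  by move=> x; rewrite inE => Dx; rewrite gee0_abs// nneseries_ge0// => j _ _; exact: F0.
by rewrite integral_nneseries.
Qed.

Section orthonormal_expansion.
Context (R : realType) (d : nat).
Local Notation sigma := (@surface_measure R d).
Local Notation S := (@sphere R d).
Local Notation normc := (@ComplexField.Normc.normc R).
Hypothesis finS : (sigma S < +oo)%E.
Context (N : nat -> nat) (P : forall j, 'I_(N j) -> mpoly d R[i]).
Arguments P : clear implicits.
Hypothesis orthonormal : forall j k m, inner (ev (P j k)) (ev (P j m)) = (k == m)%:R.
Hypothesis orthogonal : forall j l k m, j != l -> inner (ev (P j k)) (ev (P l m)) = 0.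
Local Notation Y j k := (ev (P j k)).

(** Real and imaginary parts are bounded separately, at the cost of a factor 2; this is enough for
    limits equal to 0. *)
Lemma normc_sphere_integral (f : d.-tuple R -> R[i]) : bounded_measurable f ->
  normc (sphere_integral f) <= \int[sigma]_(x in S) normc (f x) *+ 2.
Proof.
move=> bf; have mS := @measurable_sphere R d.
have iN := integrable_normc finS bf.
have iR := integrable_Re finS bf; have iI := integrable_Im finS bf.
have le_abs h : sigma.-integrable S (EFin \o h) -> (forall x, `|h x| <= normc (f x)) ->
    `|\int[sigma]_(x in S) h x| <= \int[sigma]_(x in S) normc (f x).
  move=> ih hf; apply: le_trans (le_normr_Rintegral mS ih) _.
  by apply: le_Rintegral => //; exact: integrable_norm ih.
apply: le_trans (ler_normc_ReIm _) _; rewrite mulr2n lerD//.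
- by apply: le_abs => // x; exact: ler_Re_normc.
- by apply: le_abs => // x; exact: ler_Im_normc.
Qed.

(* By AM-GM. *)
Lemma integral_normc_le (p q : mpoly d R[i]) (a b : R) :
  inner (ev p) (ev p) = a%:C -> inner (ev q) (ev q) = b%:C ->
  \int[sigma]_(x in S) normc (ev p x * (ev q x)^*) <= (a + b) / 2.
Proof.
move=> pp qq; have mS := @measurable_sphere R d.
have b2 (r s : mpoly d R[i]) : bounded_measurable (fun x => ev r x * (ev s x)^*).
  by apply: bounded_measurableM; [|apply: bounded_measurable_conj]; exact: bounded_measurable_ev.
pose u (r : mpoly d R[i]) x := complex.Re (ev r x * (ev r x)^*).
have i2 r : sigma.-integrable S (EFin \o u r) := integrable_Re finS (b2 r r).
have ipq : sigma.-integrable S (EFin \o (fun x => u p x + u q x)).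
  by apply: (integrableD mS (i2 p) (i2 q)).
have -> : (a + b) / 2 = \int[sigma]_(x in S) (2^-1 * (u p x + u q x)).
  rewrite RintegralZl// mulrC; congr (_ * _); rewrite RintegralD//.
  by congr (_ + _); [have /(congr1 (@complex.Re R)) := pp|have /(congr1 (@complex.Re R)) := qq].
apply: le_Rintegral => //.
- exact: integrable_normc (b2 p q).
- exact: (integrableZl mS (2^-1) ipq).
- move=> x _; rewrite ComplexField.Normc.normcM normc_conj.
  have E z : complex.Re (z * z^*) = normc z ^+ 2.
    case: z => s t /=; rewrite sqr_sqrtr ?addr_ge0 ?sqr_ge0//; ring.
  rewrite /u !E; have := sqr_ge0 (normc (ev p x) - normc (ev q x)); nra.
Qed.

Section coefficients.
Context (b : nat -> forall j, 'I_(N j) -> R[i]) (B : forall j, 'I_(N j) -> R).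
Arguments b : clear implicits.
Arguments B : clear implicits.
Hypothesis bB : forall n j k, normc (b n j k) <= B j k.
Hypothesis Boo : (\sum_(0 <= j <oo) (\sum_(k < N j) B j k)%:E < +oo)%E.
Local Notation f n x := (\sum_(j < n) \sum_(k < N j) b n j k * Y j k x).
Hypothesis f0 : {ae sigma, forall x, S x -> (fun n => normc (f n x)) @ \oo --> (0 : R)}.

Let B_ge0 j k : 0 <= B j k.
Proof. by apply: le_trans (bB 0 k); exact: normc_ge0. Qed.

Let p n := \sum_(j < n) \sum_(k < N j) b n j k *: P j k.

Let evp n x : ev (p n) x = f n x.
Proof.
rewrite ev_sum; apply: eq_bigr => j _; rewrite ev_sum; apply: eq_bigr => k _.
exact: evZ.
Qed.

Lemma inner_partial_sum n l (m : 'I_(N l)) : (l < n)%N ->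
  inner (ev (p n)) (Y l m) = b n l m.
Proof.
move=> ln; rewrite inner_ev /p mulr_suml mpoly_integral_sum//.
rewrite (bigD1 (Ordinal ln))//= [X in _ + X]big1 ?addr0; last first.
  move=> j jl; have {}jl : nat_of_ord j != l.
    by apply: contraNN jl => /eqP jl; apply/eqP/val_inj.
  rewrite mulr_suml mpoly_integral_sum// big1// => k _.
  by rewrite -scalerAl mpoly_integralZ// -inner_ev orthogonal// mulr0.
rewrite mulr_suml mpoly_integral_sum// (bigD1 m)//= [X in _ + X]big1 ?addr0.
  by rewrite -scalerAl mpoly_integralZ// -inner_ev orthonormal eqxx mulr1.
move=> k km.
by rewrite -scalerAl mpoly_integralZ// -inner_ev orthonormal (negbTE km) mulr0.
Qed.

(** Dominated convergence for the partial sums multiplied by a conjugate harmonic. The coefficients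
    may vary with [n], because in a double expansion the rows are truncated together with the outer
    sum. *)
Lemma coefficient_cvg0 l (m : 'I_(N l)) : (fun n => normc (b n l m)) @ \oo --> (0 : R).
Proof.
have mS := @measurable_sphere R d.
pose h n x : R := normc (ev (p n) x * (Y l m x)^*).
have bh q : bounded_measurable (fun x => ev q x * (Y l m x)^*).
  by apply: bounded_measurableM; [|apply: bounded_measurable_conj]; exact: bounded_measurable_ev.
pose F j x : R := \sum_(k < N j) B j k * normc (Y j k x * (Y l m x)^*).
have F0 j x : 0 <= F j x.
  by apply: sumr_ge0 => k _; rewrite mulr_ge0// normc_ge0.
have mF j : measurable_fun setT (F j).
  apply: measurable_sum => k; apply: measurable_funM; first exact: measurable_cst.
  exact: measurable_normc.
pose g x := (\sum_(0 <= j <oo) (F j x)%:E)%E.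
have ig : sigma.-integrable S g.
  apply: integrable_nneseries => //.
  - by move=> j; apply/measurable_EFinP; exact: measurable_funTS.
  - by move=> j x _; rewrite lee_fin.
  apply: le_lt_trans Boo; apply: lee_nneseries => [j _ _|j _].
    by apply: integral_ge0 => x _; rewrite lee_fin.
  rewrite /F -sumEFin.
  under eq_integral do rewrite -sumEFin.
  rewrite ge0_integral_sum//; last 2 first.
  - move=> k; apply/measurable_EFinP/measurable_funTS.
    by apply: measurable_funM; [exact: measurable_cst|exact: measurable_normc].
  - by move=> k x _; rewrite lee_fin mulr_ge0// normc_ge0.
  apply: lee_sum => k _.
  under eq_integral do rewrite EFinM.
  rewrite ge0_integralZl_EFin//; last 2 first.
  - by move=> x _; rewrite lee_fin normc_ge0.
  - by apply/measurable_EFinP/measurable_funTS; exact: measurable_normc.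
  rewrite -[leRHS]mule1 lee_wpmul2l ?lee_fin//.
  have iN := integrable_normc finS (bh (P j k)).
  rewrite -(fineK (integrable_fin_num mS iN)) lee_fin.
  (* Both square norms are 1, so $(1+1)/2=1$ bounds the integral and the dominating series
     integrates to at most the sum of the [B j k]. *)
  apply: le_trans (integral_normc_le (a := 1) (b := 1) _ _) _.
  - by rewrite orthonormal eqxx.
  - by rewrite orthonormal eqxx.
  - lra.
have hg n x : S x -> (`|(h n x)%:E| <= g x)%E.
  move=> Sx; rewrite /= ger0_norm ?normc_ge0//.
  apply: le_trans (nneseries_lim_ge n _); last by move=> j _ _; rewrite lee_fin.
  rewrite sumEFin lee_fin /h evp mulr_suml big_mkord.
  apply: le_trans (ler_normc_sum _ _ _) _; apply: ler_sum => j _.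
  rewrite mulr_suml; apply: le_trans (ler_normc_sum _ _ _) _; apply: ler_sum => k _.
  by rewrite -mulrA ComplexField.Normc.normcM ler_wpM2r ?normc_ge0.
have hcvg : {ae sigma, forall x, S x -> (fun n => (h n x)%:E) @ \oo --> 0%E}.
  apply: filterS f0 => x + Sx => /(_ Sx) fx.
  apply: cvg_EFin; first exact: nearW.
  rewrite [X in X @ _ --> _](_ : _ = fun n => normc (f n x) * normc ((Y l m x)^*)).
    by rewrite -[X in _ --> X](mul0r (normc ((Y l m x)^*))); apply: cvgMl.
  by apply/funext => n; rewrite /= /h evp ComplexField.Normc.normcM.
have mh n : measurable_fun S (EFin \o h n).
  by apply/measurable_EFinP/measurable_funTS; exact: measurable_normc.
have [_ _] := dominated_convergence mS mh (measurable_cst 0%E) hcvg ig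
  (aeW _ (fun x n Sx => hg n x Sx)).
rewrite integral0 => /fine_cvg /= Ih.
have I2 : (fun n => (fine (\int[sigma]_(x in S) (h n x)%:E)) *+ 2) @ \oo --> (0 : R).
  by rewrite -[X in _ --> X](mul0rn _ 2); apply: cvgMn.
apply: (squeeze_cvgr _ (cvg_cst 0) I2).
(* Only for [n > l] does the partial sum contain the term of degree [l]. *)
near=> n; rewrite normc_ge0/=.
rewrite -(@inner_partial_sum n l m); last by near: n; exact: nbhs_infty_gt.
exact: (normc_sphere_integral (bh (p n))).
Unshelve. all: by end_near.
Qed.

End coefficients.

End orthonormal_expansion.

(** * Uniqueness of the coefficients of a double expansion *)

Lemma nneseries_ge_term (R : realType) (u : nat -> \bar R) j :
  (forall n, 0 <= u n)%E -> (u j <= \sum_(0 <= n <oo) u n)%E.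
Proof.
move=> u0; apply: le_trans (nneseries_lim_ge j.+1 _); last by move=> n _ _; exact: u0.
by rewrite big_nat_recr//= leeDr// sume_ge0.
Qed.

Lemma eq_cvg_seq (R : realType) (u v : nat -> R) (l : R) :
  u =1 v -> u @ \oo --> l -> v @ \oo --> l.
Proof. by move=> /funext ->. Qed.

Section double_expansion.
Context (R : realType) (d : nat).
Local Notation sigma := (@surface_measure R d).
Local Notation S := (@sphere R d).
Local Notation normc := (@ComplexField.Normc.normc R).
Hypothesis finS : (sigma S < +oo)%E.
Context (N : nat -> nat) (P : forall j, 'I_(N j) -> mpoly d R[i]).
Arguments P : clear implicits.
Hypothesis orthonormal : forall j k m, inner (ev (P j k)) (ev (P j m)) = (k == m)%:R.
Hypothesis orthogonal : forall j l k m, j != l -> inner (ev (P j k)) (ev (P l m)) = 0.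
Local Notation Y j k := (ev (P j k)).
Context (a : forall j j', 'I_(N j) -> 'I_(N j') -> R[i]).
Arguments a : clear implicits.
Hypothesis aoo : (\sum_(0 <= j <oo) \sum_(0 <= j' <oo)
  (\sum_(k < N j) \sum_(k' < N j') normc (a j j' k k'))%:E < +oo)%E.
Hypothesis a0 : forall xi zeta, S xi -> S zeta ->
  (fun n : nat => normc (\sum_(j < n) \sum_(j' < n) \sum_(k < N j) \sum_(k' < N j')
     a j j' k k' * Y j k xi * (Y j' k' zeta)^*)) @ \oo --> (0 : R).

(** No factor in [xi] appears: for fixed [zeta] this dominates the coefficients of the expansion in
    [xi]. *)
Let F j j' zeta : R :=
  \sum_(k < N j) \sum_(k' < N j') normc (a j j' k k') * normc (Y j' k' zeta).

Let F_ge0 j j' zeta : 0 <= F j j' zeta.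
Proof.
by apply: sumr_ge0 => k _; apply: sumr_ge0 => k' _; rewrite mulr_ge0 ?normc_ge0.
Qed.

Let G zeta : \bar R := (\sum_(0 <= j <oo) \sum_(0 <= j' <oo) (F j j' zeta)%:E)%E.

Let A j j' : R := \sum_(k < N j) \sum_(k' < N j') normc (a j j' k k').

Let A_ge0 j j' : 0 <= A j j'.
Proof. by apply: sumr_ge0 => k _; apply: sumr_ge0 => k' _; exact: normc_ge0. Qed.

Let integral_F : exists2 C : R, 0 <= C & forall j j',
  (\int[sigma]_(x in S) (F j j' x)%:E <= C%:E * (A j j')%:E)%E.
Proof.
have mS := @measurable_sphere R d.
pose s := \int[sigma]_(x in S) (1 : R).
have s0 : 0 <= s by exact: Rintegral_ge0.
(* The constant polynomial 1 has square norm $s$. Paired with a harmonic in the AM-GM bound, it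
   gives $\int|Y|\le(1+s)/2$, the constant chosen below. *)
have one : inner (ev (1 : mpoly d R[i])) (ev 1) = s%:C.
  have ev1 x : ev (1 : mpoly d R[i]) x = 1 by exact: meval1.
  rewrite /inner /sphere_integral; congr (_ +i* _).
    by apply: eq_Rintegral => x _; rewrite ev1 mul1r.
  transitivity (\int[sigma]_(x in S) (0 : R)).
    by apply: eq_Rintegral => x _; rewrite ev1 mul1r; exact: oppr0.
  by rewrite Rintegral_cst// mul0r.
have bY j k := bounded_measurable_ev (P j k).
have mN j k : measurable_fun S (fun x => normc (Y j k x)).
  by apply: measurable_funTS; exact: measurable_normc.
have mY j k : measurable_fun S (fun x => (normc (Y j k x))%:E).
  by apply/measurable_EFinP/measurable_funTS; exact: measurable_normc.
have IY j k : (\int[sigma]_(x in S) (normc (Y j k x))%:E <= ((1 + s) / 2)%:E)%E.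
  rewrite -(fineK (integrable_fin_num mS (integrable_normc finS (bY j k)))) lee_fin.
  have := @integral_normc_le _ _ finS (P j k) 1 1 s _ one.
  rewrite orthonormal eqxx => /(_ erefl); apply: le_trans.
  rewrite le_eqVlt; apply/orP; left; apply/eqP.
  apply: eq_Rintegral => x _.
  by rewrite ComplexField.Normc.normcM normc_conj [ev 1 x]meval1 ComplexField.Normc.normc1 mulr1.
exists ((1 + s) / 2); first by rewrite divr_ge0// addr_ge0.
move=> j j'; rewrite /F /A.
under eq_integral do rewrite -sumEFin.
rewrite ge0_integral_sum//; last 2 first.
- move=> k; apply/measurable_EFinP; apply: measurable_sum => k'.
  by apply: measurable_funM; [exact: measurable_cst|exact: mN].
- by move=> k x _; rewrite lee_fin sumr_ge0// => k' _; rewrite mulr_ge0 ?normc_ge0.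
rewrite -EFinM mulr_sumr -sumEFin; apply: lee_sum => k _.
under eq_integral do rewrite -sumEFin.
rewrite ge0_integral_sum//; last 2 first.
- move=> k'; apply/measurable_EFinP.
  by apply: measurable_funM; [exact: measurable_cst|exact: mN].
- by move=> k' x _; rewrite lee_fin mulr_ge0 ?normc_ge0.
rewrite mulr_sumr -sumEFin; apply: lee_sum => k' _.
under eq_integral do rewrite EFinM.
rewrite ge0_integralZl_EFin ?normc_ge0//; last first.
  by move=> x _; rewrite lee_fin normc_ge0.
by rewrite mulrC EFinM lee_wpmul2l ?lee_fin ?normc_ge0.
Qed.

(** Tonelli for both sums. It follows that [G zeta] is finite for almost every [zeta] on the
    sphere. *)
Let integrable_G : sigma.-integrable S G.
Proof.
have mS := @measurable_sphere R d.
have [C C0 IF] := integral_F.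
have mF j j' : measurable_fun S (fun x => (F j j' x)%:E).
  apply/measurable_EFinP/measurable_funTS.
  apply: measurable_sum => k; apply: measurable_sum => k'.
  apply: measurable_funM; first exact: measurable_cst.
  by apply: measurable_normc; exact: bounded_measurable_ev.
have Aj j : (\sum_(0 <= j' <oo) (A j j')%:E < +oo)%E.
  apply: le_lt_trans aoo.
  apply: (nneseries_ge_term (u := fun j => \sum_(0 <= j' <oo) (A j j')%:E)%E) => i.
  by apply: nneseries_ge0 => n _ _; rewrite lee_fin.
have CA j : (\sum_(0 <= j' <oo) \int[sigma]_(x in S) (F j j' x)%:E <=
    C%:E * \sum_(0 <= j' <oo) (A j j')%:E)%E.
  rewrite -nneseriesZl; last by move=> i _; rewrite lee_fin.
  apply: lee_nneseries => [i _ _|i _]; last exact: IF.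
  by apply: integral_ge0 => x _; rewrite lee_fin.
have iF j : sigma.-integrable S (fun x => \sum_(0 <= j' <oo) (F j j' x)%:E)%E.
  apply: integrable_nneseries => //.
    by move=> j' x _; rewrite lee_fin.
  by apply: le_lt_trans (CA j) _; rewrite lte_mul_pinfty.
apply: integrable_nneseries => //.
- by move=> j; exact: measurable_int (iF j).
- by move=> j x _; apply: nneseries_ge0 => n _ _; rewrite lee_fin.
apply: (@le_lt_trans _ _ (C%:E * \sum_(0 <= j <oo) \sum_(0 <= j' <oo) (A j j')%:E)%E).
  rewrite -nneseriesZl; last first.
    by move=> i _; apply: nneseries_ge0 => n _ _; rewrite lee_fin.
  apply: lee_nneseries => [i _ _|i _].
    apply: integral_ge0 => x _; apply: nneseries_ge0 => n _ _; rewrite lee_fin//.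
  rewrite integral_nneseries//; first by move=> j' x _; rewrite lee_fin.
by rewrite lte_mul_pinfty.
Qed.

(** For fixed [zeta] the square partial sums form an expansion in [xi] whose coefficients are the
    rows cut at [n]. The absolute row sums [H j k] dominate them for all [n] and add up to
    [G zeta]. *)
Let row_cvg0 zeta l (m : 'I_(N l)) : S zeta -> G zeta \is a fin_num ->
  (fun n => normc (\sum_(j' < n) \sum_(k' < N j') a l j' m k' * (Y j' k' zeta)^*))
  @ \oo --> (0 : R).
Proof.
move=> Sz Gz.
pose H j (k : 'I_(N j)) : \bar R :=
  (\sum_(0 <= j' <oo) (\sum_(k' < N j') normc (a j j' k k') * normc (Y j' k' zeta))%:E)%E.
have t0 j j' k : (0 <= (\sum_(k' < N j') normc (a j j' k k') * normc (Y j' k' zeta))%:E)%E.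
  by rewrite lee_fin sumr_ge0// => k' _; rewrite mulr_ge0 ?normc_ge0.
have H0 j k : (0 <= H j k)%E by apply: nneseries_ge0 => n _ _; exact: t0.
have sumH j : (\sum_(k < N j) H j k = \sum_(0 <= j' <oo) (F j j' zeta)%:E)%E.
  rewrite /H -nneseries_sum; last by move=> k j' _; exact: t0.
  by apply: eq_eseriesr => j' _; rewrite sumEFin.
have Hfin j k : H j k \is a fin_num.
  rewrite ge0_fin_numE//; apply: (@le_lt_trans _ _ (G zeta)); last first.
    by rewrite ltey_eq Gz.
  apply: (@le_trans _ _ (\sum_(k < N j) H j k)%E).
    by rewrite (bigD1 k)//= leeDl// sume_ge0.
  rewrite sumH /G.
  apply: (nneseries_ge_term (u := fun j => \sum_(0 <= j' <oo) (F j j' zeta)%:E)%E) => i.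
  by apply: nneseries_ge0 => n _ _; rewrite lee_fin.
pose b n j (k : 'I_(N j)) := \sum_(j' < n) \sum_(k' < N j') a j j' k k' * (Y j' k' zeta)^*.
apply: (@coefficient_cvg0 _ _ finS _ P orthonormal orthogonal b (fun j k => fine (H j k))).
- move=> n j k; rewrite -lee_fin fineK//.
  apply: le_trans (nneseries_lim_ge n _); last by move=> j' _ _; exact: t0.
  rewrite sumEFin lee_fin big_mkord.
  apply: le_trans (ler_normc_sum _ _ _) _; apply: ler_sum => j' _.
  apply: le_trans (ler_normc_sum _ _ _) _; apply: ler_sum => k' _.
  by rewrite ComplexField.Normc.normcM normc_conj.
- rewrite (eq_eseriesr (g := fun j => \sum_(0 <= j' <oo) (F j j' zeta)%:E)%E).
    by rewrite -/(G zeta) ltey_eq Gz.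
  move=> j _; rewrite -sumH -sumEFin; apply: eq_bigr => k _; exact: fineK.
- apply: aeW => xi Sxi.
  apply: eq_cvg_seq (a0 Sxi Sz) => n; congr normc.
  apply: eq_bigr => j _; rewrite exchange_big; apply: eq_bigr => k _.
  rewrite /b mulr_suml; apply: eq_bigr => j' _.
  by rewrite mulr_suml; apply: eq_bigr => k' _; rewrite mulrAC.
Qed.

(** Second use of [coefficient_cvg0], now in [zeta]: by [row_cvg0] the expansion of row [k] tends to
    0 almost everywhere. Conjugation turns the conjugated harmonics into harmonics. *)
Lemma coefficients_eq0 j j' k k' : a j j' k k' = 0.
Proof.
have aeG := integrable_ae (@measurable_sphere R d) integrable_G.
(* The coefficients no longer depend on [n], so a constant sequence tends to 0. *)
suff /cvg_lim : (fun _ : nat => normc (a j j' k k')^*) @ \oo --> (0 : R).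
  rewrite lim_cst// normc_conj => /(_ (@Rhausdorff R)) E.
  exact: ComplexField.Normc.eq0_normc.
apply: (@coefficient_cvg0 _ _ finS _ P orthonormal orthogonal
  (fun _ l m => (a j l k m)^*) (fun l m => normc (a j l k m))).
- by move=> _ l m; rewrite normc_conj.
- apply: le_lt_trans aoo; apply: (@le_trans _ _ (\sum_(0 <= l <oo) (A j l)%:E)%E).
    apply: lee_nneseries => [l _ _|l _].
      by rewrite lee_fin sumr_ge0// => m _; exact: normc_ge0.
    rewrite lee_fin /A (bigD1 k)//= lerDl sumr_ge0// => m _.
    by rewrite sumr_ge0// => m' _; exact: normc_ge0.
  apply: (nneseries_ge_term (u := fun j => \sum_(0 <= j' <oo) (A j j')%:E)%E) => i.
  by apply: nneseries_ge0 => n _ _; rewrite lee_fin.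
- apply: filterS aeG => zeta Gz Sz.
  apply: eq_cvg_seq (row_cvg0 k Sz (Gz Sz)) => n.
  rewrite -[LHS]normc_conj rmorph_sum; congr normc; apply: eq_bigr => l _.
  by rewrite rmorph_sum; apply: eq_bigr => m _; rewrite rmorphM/= conjcK.
Qed.

End double_expansion.

(** * Antipodes and harmonics of degree 0 *)

Section harmonics.
Context (R : realType) (d : nat).
Local Notation S := (@sphere R d).
Local Notation normc := (@ComplexField.Normc.normc R).

Lemma sphere_antipode x : S x -> S (antipode x).
Proof.
rewrite /sphere/= => <-; congr Num.sqrt; apply: eq_bigr => i _.
by rewrite tnth_mktuple sqrrN.
Qed.

Lemma ev_antipode m (p : mpoly d R[i]) x : p \is ishomog1 m mdeg ->
  ev p (antipode x) = (-1) ^+ m * ev p x.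
Proof.
move=> /dhomogP hp; rewrite /ev !mevalE mulr_sumr big_seq [RHS]big_seq.
apply: eq_bigr => u up; have <- : mdeg u = m := hp u up.
rewrite mulrCA mdegE; congr (_ * _); rewrite -prodrXr -big_split/=.
by apply: eq_bigr => i _; rewrite tnth_mktuple rmorphN [LHS]exprNn.
Qed.

Lemma ev_homog0 (p : mpoly d R[i]) : p \is ishomog1 0%N mdeg ->
  exists c, forall x, ev p x = c.
Proof.
move=> /dhomogP hp; exists (mcoeff mnm0 p) => x.
have -> : p = mpolyC d (mcoeff mnm0 p); last by rewrite mcoeffC eqxx mulr1; exact: mevalC.
apply/mpolyP => u; rewrite mcoeffC.
have [<-|u0] := eqVneq mnm0 u; first by rewrite mulr1.
rewrite mulr0; apply/eqP; apply: contraNT u0; rewrite -mcoeff_msupp => /hp /eqP.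
by rewrite [X in X == _]/= mdeg_eq0 eq_sym.
Qed.

(* A constant function has square norm 1 only if the sphere has finite nonzero area,
   since a real-valued integral over a set of infinite measure is 0 here. *)
Lemma surface_area_neq0 (p : mpoly d R[i]) : p \is ishomog1 0%N mdeg ->
  inner (ev p) (ev p) = 1 ->
  surface_area R d != 0 /\ (surface_measure S < +oo)%E.
Proof.
move=> /ev_homog0[c pc] /(congr1 (@complex.Re R)); rewrite [LHS]/=.
under eq_Rintegral do rewrite pc.
rewrite Rintegral_cst; last exact: measurable_sphere.
rewrite -/(surface_area R d) => E.
have s0 : surface_area R d != 0.
  by apply/eqP => s0; move: E; rewrite s0 mulr0 => /eqP; rewrite eq_sym oner_eq0.
split => //; rewrite ltey; apply: contra s0 => /eqP soo.
by rewrite /surface_area soo.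
Qed.

End harmonics.

(** Passes from the topology of [R[i]] to real sequences of moduli, the form in which the uniqueness
    results are stated. *)
Lemma cvg_normcB (R : realType) (u v : nat -> R[i]) (l m : R[i]) :
  u @ \oo --> (l : R[i]^o) -> v @ \oo --> (m : R[i]^o) ->
  (fun n => ComplexField.Normc.normc (u n - v n - (l - m))) @ \oo --> (0 : R).
Proof.
move=> ul vm; apply/cvgrPdist_lt => e e0.
have uv := @cvgB R[i] R[i]^o nat _ eventually_filter u v l m ul vm.
have := @cvgr_dist_lt R[i] R[i]^o nat _ eventually_filter _ _ uv e%:C.
rewrite ltcR => /(_ e0); apply: filterS => n.
rewrite distrC (normc_def (u n - v n - (l - m))) ltcR sub0r normrN.
rewrite ger0_norm ?normc_ge0//.
by case: (u n - v n - (l - m)).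
Qed.

(** * Kernels invariant under the antipodal map *)

Theorem lemma4 (R : realType) (d : nat) (hd : (2 <= d)%N)
    (Y : forall j : nat, 'I_(harmonic_dim d j) -> d.-tuple R -> R[i])
    (hY : forall j : nat, orthonormal_basis_of_harmonics j (Y j))
    (a : forall j j' : nat,
       'I_(harmonic_dim d j) -> 'I_(harmonic_dim d j') -> R[i])
    (ha : (\sum_(0 <= j <oo) \sum_(0 <= j' <oo)
             (\sum_(k < harmonic_dim d j) \sum_(k' < harmonic_dim d j')
                ComplexField.Normc.normc (a j j' k k') *
                Num.sqrt ((harmonic_dim d j)%:R * (harmonic_dim d j')%:R /
                          surface_area R d ^+ 2))%:E < +oo)%E)
    (K : d.-tuple R -> d.-tuple R -> R[i])
    (hK : forall xi zeta, sphere xi -> sphere zeta ->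
       (fun n : nat => \sum_(j < n) \sum_(j' < n)
          \sum_(k < harmonic_dim d j) \sum_(k' < harmonic_dim d j')
            a j j' k k' * Y j k xi * (Y j' k' zeta)^*) @ \oo
       --> (K xi zeta : R[i]^o)) :
  (forall xi zeta, sphere xi -> sphere zeta ->
     K xi zeta = K (antipode xi) (antipode zeta))
  <->
  (forall (j j' : nat) (k : 'I_(harmonic_dim d j)) (k' : 'I_(harmonic_dim d j')),
     odd (j + j') -> a j j' k k' = 0).
Proof.
have hP j k : {p : mpoly d R[i] | [/\ p \is ishomog1 j mdeg, laplacian p = 0 &
    forall x, sphere x -> Y j k x = ev p x]}.
  by apply: cid; have [H _ _] := hY j; exact: H.
pose P j k := sval (hP j k).
have Phomog j k : P j k \is ishomog1 j mdeg by rewrite /P; case: (hP j k) => p [].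
have Plap j k : laplacian (P j k) = 0 by rewrite /P; case: (hP j k) => p [].
have PY j k x : sphere x -> Y j k x = ev (P j k) x.
  by rewrite /P; case: (hP j k) => p [] _ _ /= pY; exact: pY.
have orthonormal j k m : inner (ev (P j k)) (ev (P j m)) = (k == m)%:R.
  have [_ <- _] := hY j; apply: eq_sphere_integral => x Sx.
  by rewrite !PY.
(* [harmonic_dim d 0] computes to 1, so degree 0 has a basis element; its norm 1 makes the area
   finite and nonzero. *)
have P00 := orthonormal 0%N ord0 ord0; rewrite eqxx in P00.
have [area0 finS] := surface_area_neq0 (Phomog 0%N ord0) P00.
have orthogonal j l k m : j != l -> inner (ev (P j k)) (ev (P l m)) = 0.
  move=> jl; rewrite inner_ev.
  apply: (mpoly_integral_harmonic finS hd jl) => //; first exact: homog_conj_mpoly.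
  exact: laplacian_conj_mpoly.
pose sgn j j' : R[i] := (-1) ^+ (j + j').
have sgnE xi zeta j j' k k' : sphere xi -> sphere zeta ->
    a j j' k k' * Y j k (antipode xi) * (Y j' k' (antipode zeta))^* =
    sgn j j' * (a j j' k k' * Y j k xi * (Y j' k' zeta)^*).
  move=> Sx Sz; rewrite !PY//; try exact: sphere_antipode.
  rewrite (ev_antipode _ (Phomog j k)) (ev_antipode _ (Phomog j' k')).
  rewrite rmorphM rmorphXn rmorphN1 /sgn exprD; ring.
pose u n xi zeta : R[i] := \sum_(j < n) \sum_(j' < n)
  \sum_(k < harmonic_dim d j) \sum_(k' < harmonic_dim d j')
    a j j' k k' * Y j k xi * (Y j' k' zeta)^*.
have u_cvg xi zeta (Sx : sphere xi) (Sz : sphere zeta) :=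
  cvg_normcB (hK xi zeta Sx Sz)
    (hK _ _ (sphere_antipode Sx) (sphere_antipode Sz)).
split => [K_even j j' k k' jj'|a_odd xi zeta Sx Sz]; last first.
  (* Terms of odd total degree vanish and the others have sign 1, so the partial sums at antipodal
     points coincide. *)
  have uE n : u n xi zeta = u n (antipode xi) (antipode zeta).
    do 4 (apply: eq_bigr => ? _); rewrite sgnE// /sgn -signr_odd.
    by case: (boolP (odd _)) => [/a_odd ->|_]; rewrite ?(mul0r, mulr0, mul1r).
  have /cvg_lim : (fun _ : nat => ComplexField.Normc.normc
      (- (K xi zeta - K (antipode xi) (antipode zeta)))) @ \oo --> (0 : R).
    apply: eq_cvg_seq (u_cvg _ _ Sx Sz) => n.
    by rewrite -/(u n _ _) -/(u n _ _) uE subrr add0r.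
  rewrite lim_cst// => /(_ (@Rhausdorff R)) /ComplexField.Normc.eq0_normc /eqP.
  by rewrite oppr_eq0 subr_eq0 => /eqP.
(* The coefficients of $K(\xi,\zeta)-K(-\xi,-\zeta)$, equal to $2a$ when the total degree is odd. *)
pose b l l' m m' : R[i] := (1 - sgn l l') * a l l' m m'.
suff : b j j' k k' = 0.
  move=> /eqP; rewrite /b /sgn -signr_odd jj' expr1 opprK mulf_eq0.
  by rewrite -[1 + 1]/(2%:R) pnatr_eq0/= => /eqP.
apply: (coefficients_eq0 finS orthonormal orthogonal (a := b)); last first.
  move=> xi zeta Sx Sz; apply: eq_cvg_seq (u_cvg _ _ Sx Sz) => n.
  rewrite K_even// subrr subr0 -sumrB; congr ComplexField.Normc.normc.
  apply: eq_bigr => l _; rewrite -sumrB; apply: eq_bigr => l' _.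
  rewrite -sumrB; apply: eq_bigr => m _; rewrite -sumrB; apply: eq_bigr => m' _.
  rewrite sgnE// -!PY// /b; ring.
pose w l l' : R := Num.sqrt ((harmonic_dim d l)%:R * (harmonic_dim d l')%:R /
  surface_area R d ^+ 2).
(* The 2 bounds $|1-(-1)^{l+l'}|$, and the area undoes the division in [w]: as both dimensions are
   at least 1, $|\sigma_{d-1}|\,w\ge1$. *)
pose C : R := 2 * `|surface_area R d|.
have C0 : 0 <= C by rewrite mulr_ge0.
have bw l l' m m' : ComplexField.Normc.normc (b l l' m m') <=
    C * (ComplexField.Normc.normc (a l l' m m') * w l l').
  (* The index [t] itself witnesses that the dimension is positive. *)
  have N1 i (t : 'I_(harmonic_dim d i)) : 1 <= (harmonic_dim d i)%:R :> R.
    by rewrite ler1n; apply: leq_ltn_trans (ltn_ord t).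
  have w1 : 1 <= `|surface_area R d| * w l l'.
    rewrite -sqrtr_sqr /w -sqrtrM ?sqr_ge0// mulrC divfK ?sqrf_eq0//.
    by rewrite -[leLHS]sqrtr1 ler_wsqrtr// -[leLHS]mulr1 ler_pM// N1.
  have b2 : ComplexField.Normc.normc (b l l' m m') <=
      2 * ComplexField.Normc.normc (a l l' m m').
    rewrite /b ComplexField.Normc.normcM ler_wpM2r ?normc_ge0//.
    apply: le_trans (le_normcD _ _) _; rewrite normcN /sgn -signr_odd.
    case: odd; rewrite ?expr1 ?expr0 ?normcN ComplexField.Normc.normc1; lra.
  apply: le_trans b2 _; rewrite /C -!mulrA ler_wpM2l// mulrCA.
  by rewrite ler_peMr ?normc_ge0.
pose A l l' := \sum_(m < harmonic_dim d l) \sum_(m' < harmonic_dim d l')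
  ComplexField.Normc.normc (a l l' m m') * w l l'.
have A0 l l' : (0 <= (A l l')%:E)%E.
  by rewrite lee_fin; do 2 (apply: sumr_ge0 => ? _); rewrite mulr_ge0 ?normc_ge0 ?sqrtr_ge0.
have AS l : (0 <= \sum_(0 <= l' <oo) (A l l')%:E)%E by apply: nneseries_ge0.
apply: (@le_lt_trans _ _ (C%:E * \sum_(0 <= l <oo) \sum_(0 <= l' <oo) (A l l')%:E)%E).
  rewrite -nneseriesZl; last by move=> l _; exact: AS.
  apply: lee_nneseries => [l _ _|l _].
    apply: nneseries_ge0 => l' _ _; rewrite lee_fin.
    by do 2 (apply: sumr_ge0 => ? _); exact: normc_ge0.
  rewrite -nneseriesZl; last by move=> l' _; exact: A0.
  apply: lee_nneseries => [l' _ _|l' _].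
    by rewrite lee_fin; do 2 (apply: sumr_ge0 => ? _); exact: normc_ge0.
  rewrite -EFinM lee_fin /A mulr_sumr; apply: ler_sum => m _.
  by rewrite mulr_sumr; apply: ler_sum => m' _; exact: bw.
by rewrite lte_mul_pinfty.
Qed.
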